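(* For any $\lambda\in\{\lambda_i^j: 1\leq i\leq\mu_2,\ 0\leq j\leq N_i\}$, the classes of those $\widetilde{\omega}_i^j$ for which $\lambda_i^j=\lambda$ induce a basis of the vector space $\mathrm{gr}^V_\lambda(G_0/\tau^{-1}G_0)$. Hence the numbers $\lambda_i^j$ together with their multiplicities form the spectrum of $(\mathbf{G}_0,G_0)$.
   Context: Setting. Let $\mathcal{O}=\mathbb{C}[x_1,\dots,x_{n+1}]$, graded by giving $x_i$ a positive rational weight $p_i$; ''homogeneous'' always refers to this grading. Let $g=(g_1,\dots,g_n):\mathbb{C}^{n+1}\to\mathbb{C}^n$ be a polynomial map with $g_i$ homogeneous of degree $e_i$, and assume that $C_0=g^{-1}(0)$ is a reduced complete intersection curve which is not smooth. Let $f\in\mathcal{O}$ be homogeneous of degree $1$ and such that $f_0:=f|_{C_0}$ is not constant on any branch of $C_0$. Let $J$ be the Jacobian determinant of $(f,g_1,\dots,g_n)$, $I=(g_1,\dots,g_n)$, $\mu=\dim_{\mathbb{C}}\mathcal{O}/(I+(J))$. The coordinates $t_1,\dots,t_n$ on the target of $g$ act on $\mathcal{O}$ as multiplication by $g_1,\dots,g_n$. Gauss–Manin system. Let $\alpha=dx_1\wedge\dots\wedge dx_{n+1}/dg_1\wedge\dots\wedge dg_n$, let $\omega_g=\mathcal{O}\alpha$ be the relative dualising module of $g$ and $\omega_{C_0}=\omega_g/I\omega_g$. The relative differential $d:\mathcal{O}\to\omega_g$ is $dh=J_h\alpha$, with $J_h$ the Jacobian determinant of $(h,g_1,\dots,g_n)$;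 in particular $df=J\alpha$. Put $$\mathbf{G}:=\frac{\omega_g[\tau,\tau^{-1}]}{(d-\tau\, df\wedge)\mathcal{O}[\tau,\tau^{-1}]},\qquad (df\wedge)h=hJ\alpha,$$ with the operator $\partial_\tau$ determined by $\partial_\tau[\omega]=[-f\omega]$ for $\omega\in\omega_g$ and the Leibniz rule in $\tau$. Let $G$ be the image of $\omega_g[\tau^{-1}]\to\mathbf{G}$ (the Brieskorn lattice; it is free of rank $\mu$ over $\mathbb{C}[t_1,\dots,t_n,\tau^{-1}]$). Put $\mathbf{G}_0=\mathbf{G}/(t_1,\dots,t_n)\mathbf{G}$ and $G_0=G/(t_1,\dots,t_n)G$. $V$-filtration and spectrum. The Malgrange–Kashiwara filtration $V_\bullet(\mathbf{G}_0)$ is the unique increasing exhaustive filtration indexed by $\mathbb{Q}$ such that: (1) each $V_\lambda$ is $\mathbb{C}[\tau]$-free and $\mathbb{C}[\tau,\tau^{-1}]\otimes_{\mathbb{C}[\tau]}V_\lambda=\mathbf{G}_0$; (2) $\tau V_\lambda=V_{\lambda-1}$ and $\partial_\tau V_\lambda\subset V_{\lambda+1}$; (3) $\tau\partial_\tau+\lambda$ is nilpotent on $\mathrm{gr}^V_\lambda=V_\lambda/V_{<\lambda}$; (4) there is a finite set $A\subset[0,1)$ such that $V_\lambda=V_{\lambda'}$ where $\lambda'$ is the largest element of $A+\mathbb{Z}$ with $\lambda'\le\lambda$ (so $\mathrm{gr}^V_\lambda=0$ for $\lambda\notin A+\mathbb{Z}$). Define $$\mathrm{gr}^V_\lambda(G_0/\tau^{-1}G_0):=\frac{V_\lambda\cap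 G_0}{V_\lambda\cap\tau^{-1}G_0+V_{<\lambda}\cap G_0},\qquad d(\lambda)=\dim_{\mathbb{C}}\mathrm{gr}^V_\lambda(G_0/\tau^{-1}G_0).$$ The spectrum of $(\mathbf{G}_0,G_0)$ is the set of pairs $(\lambda,d(\lambda))$ with $d(\lambda)\neq0$. Basis. Let $\mu_2=\dim_{\mathbb{C}}\mathcal{O}/((f)+I)-1$. Multiplication by $-f_0$ on $\omega_{C_0}/\mathcal{O}_{C_0}df_0\cong\mathcal{O}/(I+(J))$ is nilpotent and homogeneous with $\mu_2$-dimensional kernel. Fix a homogeneous Jordan basis: homogeneous $\omega_1^0,\dots,\omega_{\mu_2}^0\in\omega_g$ and integers $N_i\geq0$ such that, with $\omega_i^j:=(-f)^j\omega_i^0$, the classes of $\omega_i^j$ $(1\le i\le\mu_2,\ 0\le j\le N_i)$ form a basis of $\omega_{C_0}/\mathcal{O}_{C_0}df_0$, and $f\omega_i^{N_i}$ has zero class. Put $\mathbf{e}=\sum e_i$, $\mathbf{p}=\sum p_i$; for $\omega=h\alpha$ with $h$ homogeneous let $\nu(\omega)=\deg h+\mathbf{p}-\mathbf{e}$, and $\nu_i^j:=\nu(\omega_i^j)$. One has $\nu_i^0\le1$. Define $$\widetilde{\omega}_i^j=\begin{cases}[\omega_i^j]+(\nu_i^j-1)\tau^{-1}[\omega_i^{j-1}] & \text{if }\nu_i^j>1,\\ [\omega_i^j] & \text{if }\nu_i^j\leq1,\end{cases}\qquad \lambda_i^j=\begin{cases}1&\text{if }\nu_i^j>1,\\ \nu_i^j&\text{if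 }0\leq\nu_i^j\leq1,\\ 0&\text{if }\nu_i^j<0.\end{cases}$$ *)

(* Defs.v *)
From HB Require Import structures.
From mathcomp Require Import all_boot all_order all_algebra.
From mathcomp Require Import classical_sets.
From mathcomp Require Import freeg mpoly.

Set Implicit Arguments.
Unset Strict Implicit.
Unset Printing Implicit Defensive.

Import Order.TTheory GRing.Theory Num.Theory.
Local Open Scope ring_scope.
Local Open Scope classical_set_scope.

(* Quotients are never formed as types: a subquotient A / B of a vector space
   V is given by the subspaces B and A of V, and a subspace of a quotient V / N
   by its preimage in V, which is a subspace containing N. *)
Section Subquotients.
Variables (K : fieldType) (V : lmodType K).
Implicit Types A B : set V.

(* The classes modulo B of the vectors v t form a basis of A / (A `&` B). *)
Definition quot_basis (T : finType) A B (v : T -> V) : Prop :=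
  [/\ forall t, A (v t),
      forall u, A u -> exists c : T -> K, B (u - \sum_t c t *: v t)
    & forall c : T -> K, B (\sum_t c t *: v t) -> forall t, c t = 0].

Definition quot_dim A B (d : nat) : Prop :=
  exists v : 'I_d -> V, quot_basis A B v.

Definition sumset A B : set V := [set a + b | a in A & b in B].

End Subquotients.

Section WeightedPolynomials.
Variables (K : fieldType) (m : nat) (p : 'I_m -> rat).

Definition weight (a : 'X_{1..m}) : rat := \sum_i p i *+ a i.

Definition whomog (d : rat) (h : {mpoly K[m]}) : Prop :=
  {in msupp h, forall a, weight a = d}.

Definition whomogeneous (h : {mpoly K[m]}) : Prop := exists d, whomog d h.

(* The degree of h, when h is homogeneous and nonzero. *)
Definition wdeg (h : {mpoly K[m]}) : rat := weight (mlead h).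

End WeightedPolynomials.

Section Ideals.
Variable (O : comNzRingType).

Definition ideal (n : nat) (g : 'I_n -> O) : set O :=
  [set h | exists a : 'I_n -> O, h = \sum_i a i * g i].

(* I + (x) *)
Definition ideal_adjoin (I : set O) (x : O) : set O :=
  [set h | exists a, I (h - a * x)].

Definition prime_over (I : set O) (P : {pred O}) : Prop :=
  [/\ idealr_closed P, prime_idealr_closed P & forall h, I h -> h \in P].

Definition minimal_prime_over (I : set O) (P : {pred O}) : Prop :=
  prime_over I P /\
  forall Q : {pred O}, prime_over I Q -> {subset Q <= P} -> Q =i P.

(* A chain P_0 < P_1 < ... < P_d of primes containing I. *)
Definition prime_chain (I : set O) (d : nat) : Prop :=
  exists P : 'I_d.+1 -> {pred O},
    (forall k, prime_over I (P k)) /\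
    (forall k l : 'I_d.+1, (k < l)%N ->
       {subset P k <= P l} /\ exists2 x, x \in P l & x \notin P k).

(* O / I has Krull dimension d. *)
Definition krull_dim (I : set O) (d : nat) : Prop :=
  prime_chain I d /\ ~ prime_chain I d.+1.

Definition radical_ideal (I : set O) : Prop :=
  forall (h : O) (k : nat), I (h ^+ k) -> I h.

End Ideals.

Section Curve.
Variables (C : fieldType) (n : nat).
Local Notation O := {mpoly C[n.+1]}.
Variables (g : 'I_n -> O) (f : O).

(* C_0 = g^-1(0), with its scheme structure Spec O / (g_1, ..., g_n), is a
   reduced curve; it is a complete intersection since its codimension n is
   the number of equations. *)
Definition reduced_ci_curve : Prop :=
  krull_dim (ideal g) 1 /\ radical_ideal (ideal g).

Definition jacobian_mx_at (x : 'I_n.+1 -> C) : 'M[C]_(n, n.+1) :=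
  \matrix_(i, j) (mderiv j (g i)).@[x].

(* This is smoothness of C_0 when reduced_ci_curve holds. *)
Definition smooth_curve : Prop :=
  forall x : 'I_n.+1 -> C,
    (forall i, (g i).@[x] = 0) -> \rank (jacobian_mx_at x) = n.

(* C_0 is quasi-homogeneous for positive weights, so that its irreducible
   components V(P) are unibranch: a function is constant on a branch of C_0 if
   and only if it is constant on the component which contains this branch. *)
Definition nonconstant_on_branches : Prop :=
  forall P : {pred O}, minimal_prime_over (ideal g) P ->
    forall c : C, f - c%:MP \notin P.

(* J_h, the Jacobian determinant of (h, g_1, ..., g_n). *)
Definition jac (h : O) : O :=
  \det (\matrix_(i, j) mderiv j (if unlift ord0 i is Some k then g k else h)).

(* h alpha in omega_g = O alpha is represented by h throughout; this is then
   the preimage of O_{C_0} df_0 in omega_g. *)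
Definition df_omega : set O := ideal_adjoin (ideal g) (jac f).

End Curve.

(* omega_g[tau, tau^-1]: << h *g k >> is tau^k h alpha. The library structure
   of {freeg int / O} is that of an O-module, and laurent C n is the
   underlying vector space over C. *)
Definition laurent (C : fieldType) (n : nat) : Type :=
  {freeg int / {mpoly C[n.+1]}}.

HB.instance Definition _ (C : fieldType) (n : nat) :=
  GRing.Zmodule.copy (laurent C n) {freeg int / {mpoly C[n.+1]}}.

Section LaurentScale.
Variables (C : fieldType) (n : nat).
Local Notation M := {freeg int / {mpoly C[n.+1]}}.
Implicit Types (c : C) (u v : laurent C n).

Definition laurent_scale c u : laurent C n := c%:MP *: (u : M).

Fact laurent_scaleA c c' u :
  laurent_scale c (laurent_scale c' u) = laurent_scale (c * c') u.
Proof. by rewrite /laurent_scale scalerA mpolyCM. Qed.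

Fact laurent_scale1 : left_id 1 laurent_scale.
Proof. by move=> u; rewrite /laurent_scale mpolyC1 scale1r. Qed.

Fact laurent_scaleDr : right_distributive laurent_scale +%R.
Proof. by move=> c u v; rewrite /laurent_scale scalerDr. Qed.

Fact laurent_scaleDl u : {morph laurent_scale^~ u : c c' / c + c'}.
Proof. by move=> c c'; rewrite /laurent_scale mpolyCD scalerDl. Qed.

HB.instance Definition _ := GRing.Zmodule_isLmodule.Build C (laurent C n)
  laurent_scaleA laurent_scale1 laurent_scaleDr laurent_scaleDl.

End LaurentScale.

Section GaussManin.
Variables (C : fieldType) (n : nat).
Local Notation O := {mpoly C[n.+1]}.
Local Notation M := {freeg int / O}.
Local Notation L := (laurent C n).
Variables (g : 'I_n -> O) (f : O).

Definition alpha_form (h : O) : L := << h *g 0 >>.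

(* Multiplication by tau^k. *)
Definition tau (k : int) (u : L) : L :=
  fglift (fun j => << (j + k)%R >> : M) u.

Definition polytau (q : {poly C}) (u : L) : L :=
  \sum_(j < size q) q`_j *: tau j%:Z u.

(* d_tau (tau^k h alpha) = k tau^(k-1) h alpha - tau^k f h alpha *)
Definition dtau (u : L) : L :=
  fglift (fun k : int => << k%:~R *g (k - 1)%R >> - << f *g k >> : M) u.

(* (d - tau df /\) u, for u in O[tau, tau^-1]. *)
Definition twisted_d (u : M) : L :=
  \sum_(k <- dom u)
    (<< jac g (coeff k u) *g k >> - << coeff k u * jac g f *g (k + 1)%R >>).

(* The kernel of omega_g[tau, tau^-1] -> GM, the Gauss-Manin system of f, g. *)
Definition GM_rel : set L := range twisted_d.

(* The kernel of omega_g[tau, tau^-1] -> GM_0 = GM / (t_1, ..., t_n) GM, with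
   t_i acting as g_i. *)
Definition GM0_rel : set L :=
  [set u | exists2 r, GM_rel r & exists b : 'I_n -> M,
     u = r + \sum_i g i *: b i :> M].

(* The preimage of the Brieskorn lattice G_0, seen in GM_0 as the image of
   omega_g[tau^-1]. *)
Definition lattice0 : set L :=
  [set u | exists2 w : M, (forall k : int, 0 < k -> coeff k w = 0)
                        & GM0_rel (u - w)].

(* S represents a basis of W / N over C[tau]. *)
Definition tau_basis (N W S : set L) : Prop :=
  [/\ S `<=` W,
      forall u, W u -> exists (s : seq L) (q : L -> {poly C}),
        (forall x, x \in s -> S x) /\ N (u - \sum_(x <- s) polytau (q x) x)
    & forall (s : seq L) (q : L -> {poly C}), uniq s ->
        (forall x, x \in s -> S x) -> N (\sum_(x <- s) polytau (q x) x) ->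
        forall x, x \in s -> q x = 0].

Definition Vlt (V : rat -> set L) (l : rat) : set L :=
  \bigcup_(k in [set k : rat | k < l]) V k.

(* x belongs to A + Z. *)
Definition in_shifts (A : seq rat) (x : rat) : Prop :=
  exists2 a, a \in A & exists z : int, x = a + z%:~R.

(* The Malgrange-Kashiwara filtration of GM_0. As tau is bijective on GM_0,
   the map from C[tau, tau^-1] (x) V l to GM_0 is always injective; MK_gen is
   its surjectivity. *)
Record MK_filtration (V : rat -> set L) : Prop := {
  MK_rel : forall l, GM0_rel `<=` V l;
  MK_submod : forall l, submod_closed (mem (V l));
  MK_tau_stable : forall l u, V l u -> V l (tau 1 u);
  MK_increasing : forall k l, k <= l -> V k `<=` V l;
  MK_exhaustive : \bigcup_l V l = setT;
  MK_free : forall l, exists S, tau_basis GM0_rel (V l) S;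
  MK_gen : forall l u, exists k : nat, V l (tau k%:Z u);
  MK_tau : forall l, tau 1 @` V l = V (l - 1);
  MK_dtau : forall l, dtau @` V l `<=` V (l + 1);
  MK_nilpotent : forall l, exists k : nat, forall u, V l u ->
    Vlt V l (iter k (fun x => tau 1 (dtau x) + ratr l *: x) u);
  MK_discrete : exists A : seq rat,
    (forall a, a \in A -> 0 <= a < 1) /\
    forall l, exists l', [/\ in_shifts A l', l' <= l,
      forall k, in_shifts A k -> k <= l -> k <= l' & V l = V l']
}.

(* gr^V_l (G_0 / tau^-1 G_0) is grV_num V l / grV_den V l. *)
Definition grV_num (V : rat -> set L) (l : rat) : set L := V l `&` lattice0.

Definition grV_den (V : rat -> set L) (l : rat) : set L :=
  sumset (V l `&` (tau (- 1) @` lattice0)) (Vlt V l `&` lattice0).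

Definition spectrum (V : rat -> set L) : set (rat * nat) :=
  [set x | quot_dim (grV_num V x.1) (grV_den V x.1) x.2 /\ x.2 != 0%N].

End GaussManin.

Section JordanBasis.
Variables (C : fieldType) (n : nat).
Local Notation O := {mpoly C[n.+1]}.
Variables (p : 'I_n.+1 -> rat) (e : 'I_n -> rat).
Variables (g : 'I_n -> O) (f : O).
Variables (mu2 : nat) (N : 'I_mu2 -> nat) (w : 'I_mu2 -> O).

(* The pairs (i, j) with 0 <= j <= N i. *)
Definition jidx : finType := {i : 'I_mu2 & 'I_(N i).+1}.

Definition nu (h : O) : rat := wdeg p h + \sum_i p i - \sum_i e i.

Definition omega (i : 'I_mu2) (j : nat) : O := (- f) ^+ j * w i.

Definition homog_jordan_basis : Prop :=
  [/\ forall i, whomogeneous p (w i),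
      quot_basis setT (df_omega g f)
        (fun x : jidx => omega (tag x) (tagged x))
    & forall i, df_omega g f (f * omega i (N i))].

(* As nu (omega i 0) <= 1, the form omega i j.-1 occurs for j > 0 only. *)
Definition omega_tilde (x : jidx) : laurent C n :=
  let i := tag x in let j := nat_of_ord (tagged x) in
  if 1 < nu (omega i j) then
    alpha_form (omega i j)
    + ratr (nu (omega i j) - 1) *: tau (- 1) (alpha_form (omega i j.-1))
  else alpha_form (omega i j).

Definition lam (x : jidx) : rat :=
  let v := nu (omega (tag x) (tagged x)) in
  if 1 < v then 1 else if 0 <= v then v else 0.

End JordanBasis.

(* Main.v *)
Require Import Defs.
From HB Require Import structures.
From mathcomp Require Import all_boot all_order all_algebra.
From mathcomp Require Import boolp classical_sets reals complex.
From mathcomp Require Import perm freeg mpoly ring.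

Set Implicit Arguments.
Unset Strict Implicit.
Unset Printing Implicit Defensive.

Import Order.TTheory GRing.Theory Num.Theory.
Local Open Scope ring_scope.
Local Open Scope classical_set_scope.

(** Let [I = (g_1, ..., g_n)] and write [J] for [jac g f], so that
    [df = J alpha].  On the curve [g = 0] Euler's identity becomes
    [f dh = (deg h) h df] for homogeneous [h] ([mul_jac_euler]), and [f] is a
    nonzerodivisor modulo [I], because [O / I] is reduced and [f] lies in no
    minimal prime ([f_nonzerodivisor]); so is [J], which divides a power of
    [f] modulo [I] ([jac_nonzerodivisor]).

    Let [omega^0, ..., omega^N] be a Jordan string of [-f].  In [GM_0] one has
    [tau d_tau omega^j = tau omega^(j+1)] for [j < N].  At the end of the string
    [f omega^N = u df] for some homogeneous [u] of weight [nu^N]; Euler's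
    identity and the cancellation of [f] give [du = nu^N omega^N], so that
    [tau d_tau omega^N = - nu^N omega^N] ([last_omega]).  In particular
    [nu^N >= 0], since [u] is a polynomial.  Dually [nu^0 <= 1]: in the complete
    intersection [O / (I + (f))] nothing survives in weights above its socle
    degree, which is that of [J], so that a form with [nu > 1] is a multiple of
    [f] and cannot start a string ([nu_first_le1]).  The bound for the socle
    degree is obtained from the Koszul complex ([high_weight_mem_ideal]).

    These two inequalities are what makes the forms [omega_tilde] work:
    [tau d_tau + lambda^j] maps [omega_tilde^j] to [tau omega_tilde^(j+1)], or
    to 0 when [j = N] ([euler_op_omega_tilde_next]).  Moreover the
    [omega_tilde] form a basis of [GM_0] over [C[tau, tau^-1]] and of the
    lattice [G_0] over [C[tau^-1]].  They generate because a form is, modulo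
    [df], a combination of the [omega], and [a df = tau^-1 da] with [da] of
    smaller weight ([alpha_form_span_homog]); they are independent because the
    leading coefficient in [tau] of a relation lies in [I + (J)]
    ([rel_top_coeff]).

    Hence [GM_0] is a direct sum of finite chains [tau^k omega_tilde^j],
    [tau^(k+1) omega_tilde^(j+1)], ..., on which [- tau d_tau] is triangular
    with the nonincreasing diagonal [lambda^j - k].  The axioms of [V] force
    [V_l] to be the sum of the generalized eigenspaces of [- tau d_tau] with
    eigenvalues at most [l], which by triangularity is the span of the
    [tau^k omega_tilde^j] with [lambda^j - k <= l] ([filtration_spanned]).
    As [V_l] and [G_0] are spanned by parts of a single basis, the quotient
    [gr^V_l (G_0 / tau^-1 G_0)] can be read off: the basis elements that remain
    are those with [k = 0] and [lambda^j = l]. *)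

(** * Subspaces, and subspaces spanned by parts of a basis *)

Section Subspaces.
Variables (K : fieldType) (V : lmodType K).
Implicit Types A B : set V.

Definition subspace B := B 0 /\ forall c u v, B u -> B v -> B (c *: u + v).

Lemma subspaceD B u v : subspace B -> B u -> B v -> B (u + v).
Proof. by move=> [_ h] Bu Bv; rewrite -[u]scale1r; apply: h. Qed.

Lemma subspaceZ B c u : subspace B -> B u -> B (c *: u).
Proof. by move=> [h0 h] Bu; rewrite -[_ *: _]addr0; apply: h. Qed.

Lemma subspaceN B u : subspace B -> B u -> B (- u).
Proof. by move=> hB Bu; rewrite -scaleN1r; apply: subspaceZ. Qed.

Lemma subspaceB B u v : subspace B -> B u -> B v -> B (u - v).
Proof. by move=> hB Bu Bv; apply: subspaceD => //; apply: subspaceN. Qed.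

Lemma subspace_sum B (I : Type) (r : seq I) (P : pred I) (F : I -> V) :
  subspace B -> (forall i, P i -> B (F i)) -> B (\sum_(i <- r | P i) F i).
Proof.
by move=> hB hF; elim/big_ind: _ => //; [case: hB|move=> u v; apply: subspaceD].
Qed.

Lemma subspace_sum_seq B (I : eqType) (r : seq I) (F : I -> V) :
  subspace B -> (forall i, i \in r -> B (F i)) -> B (\sum_(i <- r) F i).
Proof. by move=> hB hF; rewrite big_seq; apply: subspace_sum. Qed.

Lemma subspace_congr B u v : subspace B -> B (u - v) -> B v -> B u.
Proof. by move=> hB h Bv; rewrite -[u](subrK v); apply: subspaceD. Qed.

(** The coordinates of the [u t] form a matrix with more rows than columns,
    and hence have a nontrivial linear relation. *)
Lemma quot_span_dependent A B (d k : nat) (v : 'I_d -> V) (u : 'I_k -> V) :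
  subspace B -> quot_basis A B v -> (d < k)%N -> (forall t, A (u t)) ->
  exists c : 'I_k -> K, (exists t, c t != 0) /\ B (\sum_t c t *: u t).
Proof.
move=> hB [_ hspan _] lt_dk Au.
have /choice [M hM] : forall t, exists c, B (u t - \sum_s c s *: v s).
  by move=> t; apply: hspan.
pose Mx := \matrix_(t < k, s < d) M t s.
have kn0 : kermx Mx != 0.
  rewrite kermx_eq0 -row_leq_rank -ltnNge.
  exact: leq_ltn_trans (rank_leq_col _) lt_dk.
have [i ri1] : exists i, row i (kermx Mx) != 0.
  apply/existsP; apply: contraNT kn0; rewrite negb_exists => /forallP h.
  apply/eqP/row_matrixP => i; rewrite row0; apply/eqP.
  by have := h i; rewrite negbK.
have [c ri0 cM] : exists2 c : 'rV_k, c != 0 & c *m Mx = 0.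
  by exists (row i (kermx Mx)); rewrite // -row_mul mulmx_ker row0.
exists (fun t => c 0 t); split.
  apply/existsP; apply: contraNT ri0; rewrite negb_exists => /forallP h.
  by apply/eqP/rowP => t; rewrite [RHS]mxE; apply/eqP; have := h t; rewrite negbK.
have -> : \sum_t c 0 t *: u t = \sum_t c 0 t *: (u t - \sum_s M t s *: v s).
  have cMv : \sum_s (c *m Mx) 0 s *: v s = 0.
    by rewrite cM big1 // => s _; rewrite mxE scale0r.
  rewrite -[LHS]subr0 -[X in _ - X]cMv.
  rewrite [RHS](eq_bigr (fun t => c 0 t *: u t - c 0 t *: (\sum_s M t s *: v s)));
    last by move=> t _; rewrite scalerBr.
  rewrite sumrB; congr (_ - _); symmetry.
  rewrite [LHS](eq_bigr (fun t => \sum_s c 0 t *: (M t s *: v s)));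
    last by move=> t _; rewrite scaler_sumr.
  rewrite exchange_big /=; apply: eq_bigr => s _.
  rewrite mxE scaler_suml; apply: eq_bigr => t _.
  by rewrite mxE scalerA.
by apply: subspace_sum => // t _; apply: subspaceZ.
Qed.

Lemma quot_dim_le A B d k :
  subspace B -> quot_dim A B d -> quot_dim A B k -> (k <= d)%N.
Proof.
move=> hB [v hv] [u [Au _ uind]]; rewrite leqNgt; apply/negP => lt_dk.
have [c [[t /eqP ct] Bc]] := quot_span_dependent hB hv lt_dk Au.
by case: ct; apply: uind.
Qed.

Lemma quot_dim_uniq A B d k :
  subspace B -> quot_dim A B d -> quot_dim A B k -> d = k.
Proof.
move=> hB hd hk; apply/eqP; rewrite eqn_leq.
by rewrite (quot_dim_le hB hk hd) (quot_dim_le hB hd hk).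
Qed.

Lemma quot_basis_dim A B (T : finType) (v : T -> V) :
  quot_basis A B v -> quot_dim A B #|T|.
Proof.
move=> [Av vspan vind]; exists (v \o enum_val).
have sumE (c : T -> K) :
    \sum_(i < #|T|) c (enum_val i) *: v (enum_val i) = \sum_t c t *: v t.
  by rewrite [RHS](reindex _ (onW_bij _ (@enum_val_bij T))).
split => [t|u /vspan [c hc]|c hc t] /=; first exact: Av.
  by exists (c \o enum_val); rewrite /= sumE.
have := vind (c \o enum_rank) _ (enum_val t); rewrite /= enum_valK; apply.
rewrite -sumE /=; under eq_bigr => i _ do rewrite enum_valK.
exact: hc.
Qed.

End Subspaces.

Section Combinations.
Variables (R : nzRingType) (L : lmodType R) (Y : choiceType) (b : Y -> L).
Implicit Types c : {freeg Y / R}.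

HB.instance Definition _ :=
  GRing.isAdditive.Build {freeg Y / R} L (fglift b) (lift_is_additive b).

Lemma fglift_sum c : fglift b c = \sum_(y <- dom c) coeff y c *: b y.
Proof.
rewrite -[in LHS](freeg_sumE c) raddf_sum /=.
by apply: eq_bigr => y _; rewrite liftU.
Qed.

Lemma fgliftZ k c : fglift b (k *: c) = k *: fglift b c.
Proof.
rewrite (fglift_sum c) -[k *: c]/(fgscale k c) raddf_sum /= scaler_sumr.
by apply: eq_bigr => y _; rewrite liftU scalerA.
Qed.

End Combinations.

(** The subspaces of [L] containing [N] whose images in [L / N] are spanned by
    parts of a family [b].  When [b] is a basis of [L / N], intersections, sums
    and subquotients of such subspaces are read off the index sets. *)
Section SpannedSubspaces.
Variables (K : fieldType) (L : lmodType K) (Y : choiceType) (b : Y -> L).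
Variable N : set L.
Hypothesis N_sub : subspace N.
Implicit Types (c : {freeg Y / K}) (P Q : pred Y).

Definition spanned P : set L :=
  [set u | exists c, N (u - fglift b c) /\ forall y, coeff y c != 0 -> P y].

Lemma spanned_subspace P : subspace (spanned P).
Proof.
split.
  exists 0; split; first by rewrite raddf0 subr0; case: N_sub.
  by move=> y; rewrite coeff0 eqxx.
move=> k u v [c [Nc Pc]] [c' [Nc' Pc']]; exists (k *: c + c'); split.
  rewrite raddfD /= fgliftZ opprD addrACA -scalerBr.
  by apply: (proj2 N_sub).
move=> y; rewrite coeffD coeffZ; case: (eqVneq (coeff y c) 0) => [->|/Pc //].
by rewrite mulr0 add0r => /Pc'.
Qed.

Lemma rel_spanned P u : N u -> spanned P u.
Proof.
by exists 0; split; [rewrite raddf0 subr0|move=> y; rewrite coeff0 eqxx].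
Qed.

Lemma spanned_sub P Q u : (forall y, P y -> Q y) -> spanned P u -> spanned Q u.
Proof. by move=> PQ [c [Nc Pc]]; exists c; split => // y /Pc /PQ. Qed.

Lemma mem_spanned P y : P y -> spanned P (b y).
Proof.
exists << y >>; split; first by rewrite liftU scale1r subrr; case: N_sub.
by move=> z; rewrite coeffU mul1r; case: (eqVneq y z) => [<-|] //; rewrite eqxx.
Qed.

Lemma spanned_min P (W : set L) u : subspace W -> N `<=` W ->
  (forall y, P y -> W (b y)) -> spanned P u -> W u.
Proof.
move=> Wsub NW PW [c [Nc Pc]]; apply: (subspace_congr Wsub (NW _ Nc)).
rewrite fglift_sum; apply: subspace_sum_seq => // y.
by rewrite mem_dom => /Pc Py; apply: subspaceZ => //; apply: PW.
Qed.

Lemma spannedU P Q :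
  spanned (predU P Q) = sumset (spanned P) (spanned Q).
Proof.
rewrite eqEsubset; split.
  move=> u [c [Nc Pc]].
  pose c1 := \sum_(y <- dom c | P y) << coeff y c *g y >>.
  pose c2 := \sum_(y <- dom c | ~~ P y) << coeff y c *g y >>.
  have cE : c = c1 + c2 by rewrite -{1}(freeg_sumE c) (bigID P).
  have part (R : pred Y) : forall y,
      coeff y (\sum_(z <- dom c | R z) << coeff z c *g z >>) != 0 ->
      R y /\ coeff y c != 0.
    move=> y; rewrite raddf_sum /= => h.
    have : has (fun z => R z && (z == y) && (coeff z c != 0)) (dom c).
      apply: contraNT h => /hasPn h.
      rewrite big_seq_cond big1 // => z /andP [zc Rz].
      have := h z zc; rewrite Rz /= coeffU.
      case: (z == y) => /=; last by rewrite mulr0.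
      by rewrite negbK mulr1 => /eqP.
    by move=> /hasP [z _ /andP [/andP [Rz /eqP <-] cz]].
  exists (fglift b c1).
    exists c1; split; first by rewrite subrr; case: N_sub.
    by move=> y /part [].
  exists (u - fglift b c1); last by rewrite addrC subrK.
  exists c2; split; first by rewrite -addrA -opprD -raddfD /= -cE.
  by move=> y /part [nPy /Pc /orP []] // Py; rewrite Py in nPy.
move=> _ [u hu [v hv <-]]; apply: subspaceD; first exact: spanned_subspace.
  by apply: spanned_sub hu => y Py; apply/orP; left.
by apply: spanned_sub hv => y Py; apply/orP; right.
Qed.

Hypothesis b_free : forall c, N (fglift b c) -> c = 0.

Lemma comb_inj c c' u : N (u - fglift b c) -> N (u - fglift b c') -> c = c'.
Proof.
move=> h h'; apply/eqP; rewrite -subr_eq0; apply/eqP/b_free.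
rewrite raddfB /= -[fglift b c](subrK u) -addrA -[X in X + _]opprB addrC.
by apply: subspaceB.
Qed.

Lemma spannedI P Q : spanned P `&` spanned Q = spanned (predI P Q).
Proof.
rewrite eqEsubset; split => [u [[c [Nc Pc]] [c' [Nc' Qc']]]|u hu].
  have cc' := comb_inj Nc Nc'; exists c; split => // y cy.
  by apply/andP; split; [apply: Pc|apply: Qc'; rewrite -cc'].
by split; apply: spanned_sub hu => y /andP [].
Qed.

Lemma spanned_quot_basis P Q (T : finType) (i : T -> Y) :
  injective i -> (forall y, Q y -> P y) ->
  (forall t, P (i t) /\ ~~ Q (i t)) ->
  (forall y, P y -> ~~ Q y -> exists t, y = i t) ->
  quot_basis (spanned P) (spanned Q) (b \o i).
Proof.
move=> i_inj QP it PQ.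
pose comb (k : T -> K) : {freeg Y / K} := \sum_t << k t *g i t >>.
have combE k : \sum_t k t *: b (i t) = fglift b (comb k).
  by rewrite raddf_sum; apply: eq_bigr => t _; rewrite /= liftU.
have coef_comb k t : coeff (i t) (comb k) = k t.
  rewrite raddf_sum (bigD1 t) //= coeffU eqxx mulr1 big1 ?addr0 // => s st.
  by rewrite coeffU (inj_eq i_inj) (negPf st) mulr0.
split => [t|u [c [Nc Pc]]|k /=]; first by apply: mem_spanned; case: (it t).
  exists (fun t => coeff (i t) c); rewrite combE.
  exists (c - comb (fun t => coeff (i t) c)); split.
    by rewrite raddfB /= opprB addrA subrK.
  move=> y; rewrite coeffB => cy; apply: contraNT cy => nQy.
  case: (pselect (exists t, y = i t)) => [[t ->]|nty].
    by rewrite coef_comb subrr.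
  have -> : coeff y c = 0.
    by apply: contrapT => /eqP cy; case: nty; apply: PQ => //; apply: Pc.
  rewrite sub0r oppr_eq0 raddf_sum big1 // => t _; rewrite /= coeffU.
  by case: eqP => [ity|]; rewrite ?mulr0 //; case: nty; exists t.
rewrite combE => -[c [Nc Qc]] t.
have cE : comb k = c by apply: comb_inj Nc; rewrite subrr; case: N_sub.
apply/eqP; rewrite -coef_comb cE; apply/negPn/negP => /Qc.
by have [_ /negP] := it t.
Qed.

End SpannedSubspaces.
(** * Filtrations determined by the eigenvalues of an operator *)

Section MalgrangeKashiwara.
Variables (C : numFieldType) (L : lmodType C) (N : set L) (D : {linear L -> L}).
Variable V : rat -> set L.
Implicit Types (u v : L) (k l m : rat) (s : seq rat).

Definition below l : set L := [set u | exists2 k, k < l & V k u].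

Definition shifted m u : L := D u + ratr m *: u.

Definition shifted_prod s u : L := foldr shifted u s.

Lemma shifted_is_linear m : linear (shifted m).
Proof.
move=> c u v.
rewrite /shifted (linearP D) scalerDr !scalerA [_ * c]mulrC -scalerA.
by rewrite addrACA -scalerDr.
Qed.

HB.instance Definition _ m :=
  GRing.isLinear.Build C L L _ (shifted m) (shifted_is_linear m).

Lemma shifted_prod_is_linear s : linear (shifted_prod s).
Proof. by elim: s => [|m s IHs] c u v //=; rewrite IHs linearP. Qed.

HB.instance Definition _ s :=
  GRing.isLinear.Build C L L _ (shifted_prod s) (shifted_prod_is_linear s).

Lemma shiftedC m k u : shifted m (shifted k u) = shifted k (shifted m u).
Proof.
rewrite /shifted !(linearD D) !linearZZ /= !scalerDr !scalerA [ratr m * _]mulrC.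
by rewrite -!addrA; congr (_ + _); rewrite !addrA; congr (_ + _); rewrite addrC.
Qed.

Lemma shifted_prod_shifted s m u :
  shifted_prod s (shifted m u) = shifted m (shifted_prod s u).
Proof. by elim: s => //= k s ->; rewrite shiftedC. Qed.

Lemma shifted_prod_cat s t u :
  shifted_prod (s ++ t) u = shifted_prod s (shifted_prod t u).
Proof. exact: foldr_cat. Qed.

Lemma shifted_prodC s t u :
  shifted_prod s (shifted_prod t u) = shifted_prod t (shifted_prod s u).
Proof. by elim: s => //= m s ->; rewrite shifted_prod_shifted. Qed.

Lemma shifted_prod_split (a : pred rat) s u :
  shifted_prod s u =
  shifted_prod (filter a s) (shifted_prod (filter (predC a) s) u).
Proof.
elim: s => //= m s IHs; case: (a m) => /=; first by rewrite IHs.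
by rewrite shifted_prod_shifted IHs.
Qed.

Hypothesis N_sub : subspace N.
Hypothesis N_D : forall u, N u -> N (D u).
Hypothesis NV : forall l, N `<=` V l.
Hypothesis V_sub : forall l, subspace (V l).
Hypothesis V_D : forall l u, V l u -> V l (D u).
Hypothesis V_mono : forall k l, k <= l -> V k `<=` V l.
Hypothesis V_exhaustive : forall u, exists l, V l u.
Hypothesis V_nilpotent : forall l, exists n : nat, forall u, V l u ->
  below l (iter n (shifted l) u).
Hypothesis V_discrete : exists2 q : nat, (0 < q)%N &
  forall l, exists2 z : int, z%:~R / q%:R <= l & V l = V (z%:~R / q%:R).
Hypothesis V_separated : forall l u, (forall n : nat, V (l - n%:R) u) -> N u.

Lemma below_subspace l : subspace (below l).
Proof.
split; first by exists (l - 1); [rewrite ltrBlDr ltrDl|case: (V_sub (l - 1))].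
move=> c u v [k kl Vu] [m ml Vv]; exists (Num.max k m).
  by rewrite gt_max kl ml.
apply: (proj2 (V_sub _)); first by apply: V_mono Vu; rewrite le_max lexx.
by apply: V_mono Vv; rewrite le_max lexx orbT.
Qed.

Lemma shifted_stable (W : set L) m u :
  subspace W -> (forall v, W v -> W (D v)) -> W u -> W (shifted m u).
Proof. by move=> hW WD Wu; apply: subspaceD => //; [apply: WD|apply: subspaceZ]. Qed.

Lemma shifted_prod_stable (W : set L) s u :
  subspace W -> (forall v, W v -> W (D v)) -> W u -> W (shifted_prod s u).
Proof. by move=> hW WD Wu; elim: s => //= m s; apply: shifted_stable. Qed.

Lemma below_D l u : below l u -> below l (D u).
Proof. by case=> k kl Vu; exists k => //; apply: V_D. Qed.

(** On [V l / below l] the only eigenvalue of [- D] is [l], so that [D + m] is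
    injective there for [m != l]: if [D u + m u] is in [below l], then the
    powers of [D + l] act on the class of [u] as those of [l - m]. *)
Lemma shifted_injective_gr l m u :
  m != l -> V l u -> below l (shifted m u) -> below l u.
Proof.
move=> ml Vu hu; have [n hn] := V_nilpotent l.
have bsub := below_subspace l.
have a0 : ratr (l - m) != 0 :> C by rewrite fmorph_eq0 subr_eq0 eq_sym.
have shiftE v : shifted l v = shifted m v + ratr (l - m) *: v.
  by rewrite /shifted -addrA -scalerDl -rmorphD /= [m + _]addrC subrK.
have congr_pow : below l (iter n (shifted l) u - ratr (l - m) ^+ n *: u).
  elim: n {hn} => [|n IHn]; first by rewrite expr0 scale1r subrr; case: bsub.
  rewrite iterS; set w := iter _ _ _ in IHn *.
  have -> : shifted l w - ratr (l - m) ^+ n.+1 *: u =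
            shifted l (w - ratr (l - m) ^+ n *: u)
            + ratr (l - m) ^+ n *: shifted m u.
    have -> : shifted l (w - ratr (l - m) ^+ n *: u) =
              shifted l w - ratr (l - m) ^+ n *: shifted l u.
      by rewrite (raddfB (shifted l)) /= linearZZ.
    rewrite (shiftE u) scalerDr opprD !scalerA.
    by rewrite -exprSr addrA addrAC subrK.
  apply: subspaceD => //; last exact: subspaceZ.
  by apply: shifted_stable => // v; apply: below_D.
have : below l (ratr (l - m) ^+ n *: u).
  rewrite -[X in below l X](subKr (iter n (shifted l) u)).
  by apply: subspaceB => //; apply: hn.
move=> /(subspaceZ (ratr (l - m) ^+ n)^-1 bsub).
by rewrite scalerA mulVf ?scale1r // expf_neq0.
Qed.

Lemma shifted_prod_injective_gr l s u :
  l \notin s -> V l u -> below l (shifted_prod s u) -> below l u.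
Proof.
elim: s => [//|m s IHs]; rewrite inE negb_or => /andP [lm ls] Vu hu.
apply: IHs => //; apply: (shifted_injective_gr _ _ hu); first by rewrite eq_sym.
by apply: shifted_prod_stable => // v; apply: V_D.
Qed.

(** As [V] jumps only at multiples of some [1 / q], finitely many steps lead
    from [V l] down to [V k]. *)
Lemma V_descent k l u : V l u ->
  (forall m, k < m <= l -> V m u -> below m u) -> V k u.
Proof.
move=> Vlu step; have [q q0 disc] := V_discrete.
have q0' : 0 < q%:R :> rat by rewrite ltr0n.
have [n ln] : exists n : nat, l <= k + n%:R / q%:R.
  exists (Num.bound `|(l - k) * q%:R|).
  rewrite -lerBlDl ler_pdivlMr //; apply: ltW.
  exact: le_lt_trans (ler_norm _) (archi_boundP (normr_ge0 _)).
suff: forall m, m <= l -> m <= k + n%:R / q%:R -> V m u -> V k u.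
  by move/(_ l (lexx _) ln Vlu).
elim: n {ln} => [|n IHn] m ml mk Vm.
  by apply: V_mono Vm; rewrite mul0r addr0 in mk.
have [z zm Vz] := disc m; rewrite {}Vz in Vm.
have [zk|kz] := lerP (z%:~R / q%:R) k; first exact: V_mono Vm.
have [|m' m'z Vm'] := step _ _ Vm; first by rewrite kz (le_trans zm ml).
have [z' z'm' Vz'] := disc m'; rewrite {}Vz' in Vm'.
apply: (IHn _ _ _ Vm').
  by apply: le_trans z'm' (le_trans (ltW m'z) (le_trans zm ml)).
have zz' : (z' + 1)%:~R / q%:R <= z%:~R / q%:R :> rat.
  rewrite ler_pM2r ?invr_gt0 // ler_int lezD1.
  by have := le_lt_trans z'm' m'z; rewrite ltr_pM2r ?invr_gt0 // ltr_int.
have := le_trans zz' (le_trans zm mk).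
by rewrite rmorphD /= mulrDl -[n.+1]addn1 natrD mulrDl addrA lerD2r.
Qed.

(** By [shifted_prod_injective_gr] an element killed by a product of [D + m]
    drops from [V k] to [below k] unless [k] is one of the [m].  Going down from
    a large index, it reaches [V l] if all [m] are at most [l]; going down from
    [V l], it never stops if all [m] exceed [l].  These two facts express that
    [V l] is the sum of the generalized eigenspaces of [- D] for the eigenvalues
    at most [l]. *)
Lemma killed_le_mem l s u :
  (forall m, m \in s -> m <= l) -> N (shifted_prod s u) -> V l u.
Proof.
move=> sl Nu; have [k Vk] := V_exhaustive u.
apply: (V_descent Vk) => m /andP [lm _] Vm.
apply: (shifted_prod_injective_gr _ Vm).
  by apply: contraTN lm => /sl; rewrite -leNgt.
by exists (m - 1); [rewrite ltrBlDr ltrDl|apply: NV].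
Qed.

Lemma killed_gt_rel l s u :
  (forall m, m \in s -> l < m) -> N (shifted_prod s u) -> V l u -> N u.
Proof.
move=> sl Nu Vl; apply: (@V_separated l) => n.
apply: (V_descent Vl) => m /andP [_ ml] Vm.
apply: (shifted_prod_injective_gr _ Vm).
  by apply: contraTN ml => /sl; rewrite -ltNge.
by exists (m - 1); [rewrite ltrBlDr ltrDl|apply: NV].
Qed.

Variables (Y : choiceType) (b : Y -> L) (wt : Y -> rat) (rk : Y -> nat).
Variables (nxt : Y -> option Y) (bound : nat).
Hypothesis b_span : forall u, exists c : {freeg Y / C}, N (u - fglift b c).
Hypothesis b_free : forall c : {freeg Y / C}, N (fglift b c) -> c = 0.
Hypothesis rk_bound : forall y, (rk y <= bound)%N.
Hypothesis nxt_rk : forall y z, nxt y = Some z -> rk z = (rk y).+1.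
Hypothesis nxt_wt : forall y z, nxt y = Some z -> wt z <= wt y.
Hypothesis D_b : forall y,
  N (shifted (wt y) (b y) - (if nxt y is Some z then b z else 0)).

(** Following the chain [y, nxt y, ...] to its end, where [D + wt] kills. *)
Lemma basis_killed y :
  exists2 s, (forall m, m \in s -> m <= wt y) & N (shifted_prod s (b y)).
Proof.
have [n] := ubnP (bound.+1 - rk y); elim: n y => // n IHn y ltn.
have key t : (forall z, nxt y = Some z -> N (shifted_prod t (b z))) ->
    N (shifted_prod (rcons t (wt y)) (b y)).
  move=> ht; rewrite -cats1 shifted_prod_cat /=.
  rewrite -[shifted _ _](subrK (if nxt y is Some z then b z else 0)).
  rewrite linearD; apply: subspaceD => //.
    by apply: shifted_prod_stable.
  case: (nxt y) ht => [z|_]; first exact.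
  by rewrite linear0; case: N_sub.
case nyz: (nxt y) => [z|]; last first.
  exists [:: wt y]; first by move=> m; rewrite inE => /eqP ->.
  by apply: (key [::]) => z; rewrite nyz.
have [|t tz Nt] := IHn z.
  rewrite (nxt_rk nyz); have := rk_bound y; have := rk_bound z.
  rewrite (nxt_rk nyz) => h1 h2; rewrite subSS.
  by move: ltn; rewrite subSn // ltnS.
exists (rcons t (wt y)); last by apply: key => z'; rewrite nyz => -[<-].
move=> m; rewrite mem_rcons inE => /orP [/eqP -> //|/tz mz].
exact: le_trans mz (nxt_wt nyz).
Qed.

Lemma all_killed u : exists s, N (shifted_prod s u).
Proof.
have [c Nc] := b_span u.
suff [s Ns] : exists s, N (shifted_prod s (fglift b c)).
  exists s; rewrite -[u](subrK (fglift b c)) linearD.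
  by apply: subspaceD => //; apply: shifted_prod_stable.
rewrite fglift_sum; elim: (dom c) => [|y r [s Ns]].
  by exists [::]; rewrite big_nil; case: N_sub.
have [t _ Nt] := basis_killed y.
exists (s ++ t); rewrite big_cons linearD /=; apply: subspaceD => //.
  rewrite shifted_prod_cat; apply: shifted_prod_stable => //.
  by rewrite linearZZ; apply: subspaceZ.
by rewrite shifted_prod_cat shifted_prodC; apply: shifted_prod_stable.
Qed.

(** [D] moves basis elements to larger [rk] without raising [wt].  Hence if
    [b y] has least [rk] among the terms of [wt > l] of a combination, then its
    coefficient is merely multiplied by [m - wt y] when [D + m] is applied. *)
Lemma lead_coeff_shifted_prod l s (c : {freeg Y / C}) y :
  (forall m, m \in s -> m <= l) -> l < wt y -> coeff y c != 0 ->
  (forall z, coeff z c != 0 -> l < wt z -> (rk y <= rk z)%N) ->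
  exists c' : {freeg Y / C},
    [/\ N (shifted_prod s (fglift b c) - fglift b c'), coeff y c' != 0
      & forall z, coeff z c' != 0 -> l < wt z -> (rk y <= rk z)%N].
Proof.
move=> sl ly cy cmin; elim: s sl => [|m s IHs] sl /=.
  by exists c; split => //; rewrite subrr; case: N_sub.
have [|c' [Nc' cy' cmin']] := IHs.
  by move=> k ks; apply: sl; rewrite inE ks orbT.
have ml : m <= l by apply: sl; rewrite inE eqxx.
pose nb z : {freeg Y / C} := if nxt z is Some t then << t >> else 0.
pose phi z : {freeg Y / C} := << ratr (m - wt z) *g z >> + nb z.
have nbE z t : coeff t (nb z) != 0 -> nxt z = Some t.
  rewrite /nb; case: (nxt z) => [z'|]; rewrite ?coeff0 ?eqxx //.
  by rewrite coeffU mul1r; case: (eqVneq z' t) => [->|]; rewrite ?eqxx.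
have phiE z t : coeff t (phi z) != 0 -> z = t \/ nxt z = Some t.
  rewrite coeffD coeffU; case: (eqVneq z t) => [|_]; first by left.
  by rewrite mulr0 add0r => /nbE; right.
have coefE t : coeff t (fglift phi c') =
    \sum_(z <- dom c') coeff z c' * coeff t (phi z).
  rewrite fglift_sum raddf_sum /=.
  by apply: eq_bigr => z _; rewrite coeffZ.
exists (fglift phi c'); split.
- rewrite -[shifted_prod s _](subrK (fglift b c')) linearD /= -addrA.
  apply: subspaceD => //; first exact: shifted_stable.
  rewrite (fglift_sum b c') (fglift_sum phi c') linear_sum raddf_sum -sumrB /=.
  apply: subspace_sum => // z _; rewrite linearZZ fgliftZ -scalerBr.
  apply: subspaceZ => //; rewrite raddfD /= liftU.
  have -> : shifted m (b z) = ratr (m - wt z) *: b z + shifted (wt z) (b z).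
    by rewrite /shifted addrCA -scalerDl -rmorphD /= subrK.
  rewrite opprD addrACA subrr add0r /nb.
  case: (nxt z) (D_b z) => [t|]; first by rewrite liftU scale1r.
  by rewrite [fglift b 0]raddf0.
- have ydom : y \in dom c' by rewrite mem_dom.
  rewrite coefE (bigD1_seq y) ?uniq_dom //= big_seq_cond big1 ?addr0.
    rewrite mulf_neq0 //.
    rewrite coeffD coeffU eqxx mulr1.
    have [->|/nbE/nxt_rk/esym/eqP] := eqVneq (coeff y (nb y)) 0.
      by rewrite addr0 fmorph_eq0 subr_eq0 lt_eqF // (le_lt_trans ml).
    by rewrite -[X in _ == X]addn0 -addn1 eqn_add2l.
  move=> z /andP [zdom zy]; apply/eqP; rewrite mulf_eq0; apply/orP; right.
  apply/negPn/negP => /phiE [zy'|nzy]; first by rewrite zy' eqxx in zy.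
  have := cmin' z; rewrite -mem_dom => /(_ zdom (lt_le_trans ly (nxt_wt nzy))).
  by rewrite (nxt_rk nzy) ltnn.
move=> t; rewrite coefE => ct lt.
have /hasP [z zdom] : has (fun z => coeff t (phi z) != 0) (dom c').
  apply: contraNT ct => /hasPn h; rewrite big_seq big1 // => z /h.
  by rewrite negbK => /eqP ->; rewrite mulr0.
rewrite mem_dom in zdom => /phiE [zt|nzt]; first by apply: cmin'; rewrite -?zt // zt.
by rewrite (nxt_rk nzt) leqW // cmin' // (lt_le_trans lt) // (nxt_wt nzt).
Qed.

(** For the inclusion of [V l] in the span, factor an operator killing [u] into
    the part with exponents at most [l] and the rest.  The first factor already
    sends [u] to [N], by [killed_gt_rel]; but it could not do so if [u] involved
    a basis element of [wt] more than [l]. *)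
Theorem filtration_spanned l : V l = spanned b N (fun y => wt y <= l).
Proof.
rewrite eqEsubset; split => u; last first.
  apply: spanned_min => // y yl; have [s sy Ns] := basis_killed y.
  by apply: killed_le_mem Ns => m /sy my; apply: le_trans my yl.
move=> Vu; have [c Nc] := b_span u; exists c; split => // y cy.
rewrite leNgt; apply/negP => ly.
have [y0 [cy0 ly0 y0min]] : exists y0, [/\ coeff y0 c != 0, l < wt y0
    & forall z, coeff z c != 0 -> l < wt z -> (rk y0 <= rk z)%N].
  have [n] := ubnP (rk y); elim: n y cy ly => // n IHn y cy ly.
  rewrite ltnS => yn.
  have [[z [cz lz zy]]|nz] :=
    pselect (exists z, [/\ coeff z c != 0, l < wt z & (rk z < rk y)%N]).
    by apply: (IHn z cz lz); apply: leq_trans yn.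
  exists y; split => // z cz lz; rewrite leqNgt; apply/negP => zy.
  by apply: nz; exists z.
have [s Ns] := all_killed u.
pose low m := m <= l.
have Nlow : N (shifted_prod (filter low s) u).
  apply: (@killed_gt_rel l (filter (predC low) s)).
  - by move=> m; rewrite mem_filter /= -ltNge => /andP [].
  - by rewrite -shifted_prodC -shifted_prod_split.
  - by apply: shifted_prod_stable => // v; apply: V_D.
have lowl m : m \in filter low s -> m <= l by rewrite mem_filter => /andP [].
have [c' [Nc' c'0 _]] := lead_coeff_shifted_prod lowl ly0 cy0 y0min.
suff c'E : c' = 0 by rewrite c'E coeff0 eqxx in c'0.
apply: b_free; rewrite -[fglift b c'](subKr (shifted_prod (filter low s) u)).
apply: subspaceB => //; rewrite -[X in shifted_prod _ X](subrK (fglift b c)).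
rewrite linearD -addrA; apply: subspaceD => //.
by apply: shifted_prod_stable.
Qed.

End MalgrangeKashiwara.
(** * Weighted homogeneous polynomials and ideals *)

Section WeightedComponents.
Variables (K : fieldType) (m : nat) (p : 'I_m -> rat).
Local Notation O := {mpoly K[m]}.
Local Notation wt := (weight p).
Implicit Types (a : 'X_{1..m}) (h k : O) (d : rat).

Lemma weightD a a' : wt (a + a') = wt a + wt a'.
Proof.
by rewrite /weight -big_split; apply: eq_bigr => i _; rewrite mnmDE mulrnDr.
Qed.

Lemma weight0 : wt 0%MM = 0.
Proof. by rewrite /weight big1 // => i _; rewrite mnmE mulr0n. Qed.

Lemma weightU i : wt U_(i)%MM = p i.
Proof.
rewrite /weight (bigD1 i) //= mnm1E eqxx mulr1n big1 ?addr0 // => j ji.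
by rewrite mnm1E eq_sym (negPf ji) mulr0n.
Qed.

Lemma weight_ge0 a : (forall i, 0 < p i) -> 0 <= wt a.
Proof. by move=> p0; apply: sumr_ge0 => i _; apply/mulrn_wge0/ltW. Qed.

Lemma whomogP d h : whomog p d h <-> (forall a, h@_a != 0 -> wt a = d).
Proof.
by split => hh a; have := hh a; rewrite mcoeff_msupp.
Qed.

Lemma whomog0 d : whomog p d (0 : O).
Proof. by apply/whomogP => a; rewrite mcoeff0 eqxx. Qed.

Lemma whomogD d h k : whomog p d h -> whomog p d k -> whomog p d (h + k).
Proof.
move=> /whomogP hh /whomogP hk; apply/whomogP => a; rewrite mcoeffD.
by have [->|/hh //] := eqVneq h@_a 0; rewrite add0r => /hk.
Qed.

Lemma whomogZ d c h : whomog p d h -> whomog p d (c *: h).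
Proof.
move=> /whomogP hh; apply/whomogP => a; rewrite mcoeffZ mulf_eq0 negb_or.
by move=> /andP [_ /hh].
Qed.

Lemma whomogN d h : whomog p d h -> whomog p d (- h).
Proof. by rewrite -scaleN1r; apply: whomogZ. Qed.

Lemma whomog_sum d (I : Type) (r : seq I) (P : pred I) (F : I -> O) :
  (forall i, P i -> whomog p d (F i)) -> whomog p d (\sum_(i <- r | P i) F i).
Proof.
move=> hF; elim/big_ind: _ => //; first exact: whomog0.
by move=> h k; apply: whomogD.
Qed.

Lemma whomogM d d' h k :
  whomog p d h -> whomog p d' k -> whomog p (d + d') (h * k).
Proof.
move=> hh hk a /msuppM_le /allpairsP [[a1 a2] /= [a1h a2k ->]].
by rewrite weightD (hh _ a1h) (hk _ a2k).
Qed.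

Lemma whomogX a : whomog p (wt a) ('X_[a] : O).
Proof. by move=> a'; rewrite msuppX inE => /eqP ->. Qed.

Lemma whomogC c : whomog p 0 (c%:MP : O).
Proof.
apply/whomogP => a; rewrite mcoeffC.
by case: (a =P 0%MM) => [-> _|_]; rewrite ?weight0 // mulr0 eqxx.
Qed.

Lemma whomog_prod (I : finType) (D : I -> rat) (F : I -> O) :
  (forall i, whomog p (D i) (F i)) -> whomog p (\sum_i D i) (\prod_i F i).
Proof.
move=> hF; elim/big_ind2: _ => //; first exact: whomogC 1.
by move=> d h d' k; apply: whomogM.
Qed.

Lemma whomog_exp d h n : whomog p d h -> whomog p (n%:R * d) (h ^+ n).
Proof.
move=> hh; elim: n => [|n IHn]; first by rewrite mul0r expr0; apply: whomogC 1.
by rewrite exprS -addn1 natrD mulrDl mul1r addrC; apply: whomogM.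
Qed.

Lemma whomog_mderiv d h i : whomog p d h -> whomog p (d - p i) (mderiv i h).
Proof.
move=> /whomogP hh; apply/whomogP => a; rewrite mcoeff_mderiv => ha.
rewrite -(hh (a + U_(i))%MM) ?weightD ?weightU ?addrK //.
by apply: contraNneq ha => ->; rewrite mul0rn.
Qed.

Lemma whomog_det n (D E : 'I_n -> rat) (A : 'M[O]_n) :
  (forall i j, whomog p (D i - E j) (A i j)) ->
  whomog p (\sum_i D i - \sum_j E j) (\det A).
Proof.
move=> hA; apply: whomog_sum => s _.
rewrite -[X in whomog p X]add0r; apply: whomogM.
  by case: odd_perm; [rewrite expr1; apply: whomogN|rewrite expr0];
    apply: whomogC 1.
rewrite [\sum_j E j](reindex_inj (@perm_inj _ s)) -sumrB.
exact: whomog_prod.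
Qed.

Lemma wdeg_homog d h : whomog p d h -> h != 0 -> wdeg p h = d.
Proof. by move=> hh h0; apply: hh; apply: mlead_supp. Qed.

Definition wcomp d h : O := \sum_(a <- msupp h | wt a == d) h@_a *: 'X_[a].

Lemma mcoeff_wcomp d h a : (wcomp d h)@_a = if wt a == d then h@_a else 0.
Proof.
rewrite /wcomp raddf_sum /=.
have [ah|nah] := boolP (a \in msupp h); last first.
  rewrite (memN_msupp_eq0 nah) if_same big_seq_cond big1 // => b /andP [bh _].
  rewrite mcoeffZ mcoeffX; case: eqP => [ba|]; rewrite ?mulr0 //.
  by rewrite -ba bh in nah.
rewrite -big_filter; case: ifP => [wa|nwa].
  rewrite (bigD1_seq a) ?filter_uniq ?msupp_uniq ?mem_filter ?wa //=.
  rewrite mcoeffZ mcoeffX eqxx mulr1 big1 ?addr0 // => b ba.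
  by rewrite mcoeffZ mcoeffX (negPf ba) mulr0.
rewrite big_seq big1 // => b; rewrite mem_filter => /andP [wb _].
rewrite mcoeffZ mcoeffX; case: eqP => [ba|]; rewrite ?mulr0 //.
by rewrite ba nwa in wb.
Qed.

Lemma wcomp_is_linear d : linear (wcomp d).
Proof.
move=> c h k; apply/mpolyP => a.
rewrite mcoeffD mcoeffZ !mcoeff_wcomp mcoeffD mcoeffZ.
by case: ifP; rewrite ?mulr0 ?addr0.
Qed.

HB.instance Definition _ d := GRing.isLinear.Build K O O _ (wcomp d)
  (wcomp_is_linear d).

Lemma wcomp_homog d h : whomog p d (wcomp d h).
Proof.
apply/whomogP => a; rewrite mcoeff_wcomp; case: (wt a =P d) => // _.
by rewrite eqxx.
Qed.

Lemma wcomp_id d h : whomog p d h -> wcomp d h = h.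
Proof.
move=> /whomogP hh; apply/mpolyP => a; rewrite mcoeff_wcomp.
by have [->|/hh ->] := eqVneq h@_a 0; rewrite ?if_same ?eqxx.
Qed.

Lemma wcomp_neq d d' h : whomog p d' h -> d' != d -> wcomp d h = 0.
Proof.
move=> /whomogP hh dd'; apply/mpolyP => a; rewrite mcoeff_wcomp mcoeff0.
have [->|/hh ->] := eqVneq h@_a 0; first by rewrite if_same.
by rewrite (negPf dd').
Qed.

Lemma wcompM s d h k : whomog p s k -> wcomp d (h * k) = wcomp (d - s) h * k.
Proof.
move=> hk; rewrite [in LHS](mpolyE h) [in RHS](mpolyE h) mulr_suml !linear_sum.
rewrite mulr_suml; apply: eq_bigr => a _ /=.
rewrite -scalerAl !linearZZ -scalerAl /=; congr (_ *: _).
have [ad|ad] := eqVneq (wt a) (d - s).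
  have hX : whomog p (d - s) ('X_[a] : O) by rewrite -ad; apply: whomogX.
  by rewrite !wcomp_id // -[d](subrK s); apply: whomogM.
rewrite (wcomp_neq (@whomogX a) ad) mul0r.
apply: (wcomp_neq (whomogM (@whomogX a) hk)).
by apply: contraNneq ad => <-; rewrite addrK.
Qed.

Lemma whomog_neg d h : (forall i, 0 < p i) -> whomog p d h -> d < 0 -> h = 0.
Proof.
move=> p0 /whomogP hh d0; apply/mpolyP => a; rewrite mcoeff0.
by apply: contraTeq d0 => /hh <-; rewrite -leNgt weight_ge0.
Qed.

End WeightedComponents.

Section IdealMembership.
Variables (O : comNzRingType) (n : nat) (g : 'I_n -> O).
Implicit Types h k : O.

Lemma ideal0 : ideal g 0.
Proof. by exists (fun => 0); rewrite big1 // => i _; rewrite mul0r. Qed.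

Lemma idealD h k : ideal g h -> ideal g k -> ideal g (h + k).
Proof.
move=> [a ->] [b ->]; exists (fun i => a i + b i).
by rewrite -big_split; apply: eq_bigr => i _; rewrite mulrDl.
Qed.

Lemma idealMl k h : ideal g h -> ideal g (k * h).
Proof.
move=> [a ->]; exists (fun i => k * a i).
by rewrite mulr_sumr; apply: eq_bigr => i _; rewrite mulrA.
Qed.

Lemma idealMr k h : ideal g h -> ideal g (h * k).
Proof. by rewrite mulrC; apply: idealMl. Qed.

Lemma idealN h : ideal g h -> ideal g (- h).
Proof. by rewrite -mulN1r; apply: idealMl. Qed.

Lemma idealB h k : ideal g h -> ideal g k -> ideal g (h - k).
Proof. by move=> hh hk; apply/idealD/idealN. Qed.

Lemma ideal_gen i : ideal g (g i).
Proof.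
exists (fun j => (j == i)%:R); rewrite (bigD1 i) //= eqxx mul1r big1 ?addr0 //.
by move=> j /negPf ->; rewrite mul0r.
Qed.

Lemma ideal_sum (I : Type) (r : seq I) (P : pred I) (F : I -> O) :
  (forall i, P i -> ideal g (F i)) -> ideal g (\sum_(i <- r | P i) F i).
Proof.
move=> hF; elim/big_ind: _ => //; first exact: ideal0.
by move=> h k; apply: idealD.
Qed.

Lemma ideal_congr h k : ideal g (h - k) -> ideal g k -> ideal g h.
Proof. by move=> hk k0; rewrite -[h](subrK k); apply: idealD. Qed.

Lemma ideal_adjoin_ideal x h : ideal g h -> ideal_adjoin (ideal g) x h.
Proof. by exists 0; rewrite mul0r subr0. Qed.

End IdealMembership.

Lemma ideal_wcomp (K : fieldType) (m n : nat) (p : 'I_m -> rat)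
    (e : 'I_n -> rat) (g : 'I_n -> {mpoly K[m]}) d h :
  (forall i, whomog p (e i) (g i)) -> ideal g h -> ideal g (wcomp p d h).
Proof.
move=> hg [a ->]; exists (fun i => wcomp p (d - e i) (a i)).
by rewrite linear_sum; apply: eq_bigr => i _ /=; rewrite (wcompM _ _ (hg i)).
Qed.

Lemma ideal_subspace (K : fieldType) (m n : nat) (g : 'I_n -> {mpoly K[m]}) :
  subspace (ideal g).
Proof.
split; first exact: ideal0.
by move=> c h k hh hk; rewrite -mul_mpolyC; apply: idealD => //; apply: idealMl.
Qed.

Lemma ideal_adjoin_subspace (K : fieldType) (m n : nat)
    (g : 'I_n -> {mpoly K[m]}) x : subspace (ideal_adjoin (ideal g) x).
Proof.
split; first by apply: ideal_adjoin_ideal; apply: ideal0.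
move=> c h k [a ha] [b hb]; exists (c *: a + b).
have -> : c *: h + k - (c *: a + b) * x = c *: (h - a * x) + (k - b * x).
  by rewrite mulrDl opprD addrACA -scalerAl scalerBr.
exact: (proj2 (ideal_subspace g)).
Qed.

Section EulerIdentity.
Variables (K : numFieldType) (m : nat) (p : 'I_m -> rat).
Local Notation O := {mpoly K[m]}.

Lemma mulX_mderivX (a : 'X_{1..m}) i :
  'X_i * mderiv i ('X_[a] : O) = (a i)%:R *: 'X_[a].
Proof.
rewrite mderivX -scalerAr -mpolyXD; case: (posnP (a i)) => [->|ai].
  by rewrite !scale0r.
congr (_ *: 'X_[_]); apply/mnmP => j; rewrite mnmDE mnmBE mnm1E.
by case: eqP => [<-|_]; rewrite ?subnKC // subn0.
Qed.

Lemma euler_identity d (h : O) : whomog p d h ->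
  \sum_i (ratr (p i) *: 'X_i) * mderiv i h = ratr d *: h.
Proof.
move=> hh; rewrite {2}(mpolyE h) scaler_sumr.
have -> : \sum_i (ratr (p i) *: 'X_i) * mderiv i h =
    \sum_i \sum_(a <- msupp h) h@_a *: ((ratr (p i) * (a i)%:R) *: 'X_[a]).
  apply: eq_bigr => i _; rewrite {1}(mpolyE h) linear_sum mulr_sumr.
  apply: eq_bigr => a _; rewrite /= mderivZ -scalerAr -scalerAl mulX_mderivX.
  by rewrite !scalerA -mulrA.
rewrite exchange_big /=; apply: eq_big_seq => a ah.
rewrite -scaler_sumr -scaler_suml [RHS]scalerA [ratr d * _]mulrC -scalerA.
congr (_ *: (_ *: _)); rewrite -(hh a ah) /weight rmorph_sum /=.
by apply: eq_bigr => i _; rewrite rmorphMn /= mulr_natr.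
Qed.

End EulerIdentity.
(** * The Koszul complex and the socle degree *)

Section Koszul.
Variables (K : fieldType) (m : nat).
Local Notation O := {mpoly K[m]}.
Variables (p : 'I_m -> rat) (F : nat -> O) (d : nat -> rat).

(** The Koszul complex of [F 0, ..., F r.-1], as an iterated mapping cone:
    [(a, b)] stands for [a + e_r b], where [e_r] is mapped to [F r]. *)
Fixpoint koszul r : lmodType O :=
  if r is r'.+1 then (koszul r' * koszul r')%type : lmodType O else O^o.

Fixpoint kdiff r : koszul r -> koszul r :=
  if r is r'.+1 return koszul r -> koszul r
  then fun z => (kdiff z.1 + F r' *: z.2, - kdiff z.2) else fun=> 0.

(** Exterior multiplication by [\sum_j be j *: e_j]. *)
Fixpoint kwedge (be : nat -> O) r : koszul r -> koszul r :=
  if r is r'.+1 return koszul r -> koszul r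
  then fun z => (kwedge be z.1, be r' *: z.1 - kwedge be z.2) else fun=> 0.

Fixpoint kin (B : set O) r : koszul r -> Prop :=
  if r is r'.+1 return koszul r -> Prop
  then fun z => kin B z.1 /\ kin B z.2 else B.

(** For [c = 0]: [z] lies in exterior degree [k] and, as [e_j] has weight
    [d j], it has only terms of weight more than [W].  In general [c] and [W]
    account for the exterior factors that have been split off. *)
Fixpoint kterms (k c : nat) (W : rat) r : koszul r -> Prop :=
  if r is r'.+1 return koszul r -> Prop
  then fun z => kterms k c W z.1 /\ kterms k c.+1 (W - d r') z.2
  else fun h : O => forall a, h@_a != 0 -> c = k /\ W < weight p a.

(** The component of exterior degree 0; on boundaries it takes its values in
    the ideal generated by the [F j]. *)
Fixpoint kbase r : koszul r -> O :=
  if r is r'.+1 return koszul r -> O then fun z => kbase z.1 else id.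

Fixpoint kunit (h : O) r : koszul r :=
  if r is r'.+1 return koszul r then (kunit h r', 0) else h.

Lemma kdiff_is_linear r : linear (@kdiff r).
Proof.
elim: r => [|r IHr] c u v /=; first by rewrite scaler0 addr0.
congr (_, _) => /=.
  by rewrite IHr !scalerDr !scalerA [c * _]mulrC addrACA.
by rewrite IHr opprD scalerN.
Qed.

HB.instance Definition _ r :=
  GRing.isLinear.Build O (koszul r) (koszul r) _ (@kdiff r) (@kdiff_is_linear r).

Lemma kdiffK r (z : koszul r) : kdiff (kdiff z) = 0.
Proof.
elim: r z => //= r IHr [a b] /=; rewrite !linearD /= !IHr add0r.
rewrite linearZZ /= scalerN subrr [X in - X](raddfN (@kdiff r)) /= IHr opprK.
by [].
Qed.

Lemma kwedge_is_linear be r : linear (@kwedge be r).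
Proof.
elim: r => [|r IHr] c u v /=; first by rewrite scaler0 addr0.
congr (_, _) => /=; first exact: IHr.
by rewrite IHr !scalerDr scalerN !scalerA [c * _]mulrC opprD addrACA.
Qed.

HB.instance Definition _ be r := GRing.isLinear.Build O (koszul r) (koszul r) _
  (@kwedge be r) (@kwedge_is_linear be r).

Lemma kdiff_kwedge be r (z : koszul r) :
  kdiff (kwedge be z) + kwedge be (kdiff z) = (\sum_(j < r) be j * F j) *: z.
Proof.
elim: r z => [|r IHr]; first by move=> z; rewrite big_ord0 scale0r /= addr0.
move=> [a b] /=; rewrite big_ord_recr /=; congr (_, _) => /=.
  rewrite scalerDl -IHr (raddfD (@kwedge be r)) /= !linearZZ /=.
  by rewrite scalerBr scalerA [F r * _]mulrC addrACA subrK.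
rewrite scalerDl -IHr (raddfB (@kdiff r)) (raddfN (@kwedge be r)) /=.
rewrite !linearZZ /= scalerDr scalerA opprB opprK.
have cancel (U : zmodType) (x y z t : U) : x - y + (y + z + t) = x + t + z.
  by rewrite -(addrA y z) (addrA _ y) subrK (addrC z) addrA.
exact: cancel.
Qed.

Section SubIdeal.
Variable B : set O.
Hypothesis B0 : B 0.
Hypothesis BD : forall h h', B h -> B h' -> B (h + h').
Hypothesis BM : forall c h, B h -> B (c * h).

Lemma kin0 r : kin B (0 : koszul r).
Proof. by elim: r => [|r IHr] //=; split. Qed.

Lemma kinD r (u v : koszul r) : kin B u -> kin B v -> kin B (u + v).
Proof.
elim: r u v => [|r IHr] u v /=; first exact: BD.
by move=> [u1 u2] [v1 v2]; split; apply: IHr.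
Qed.

Lemma kinZ r c (u : koszul r) : kin B u -> kin B (c *: u).
Proof.
elim: r u => [|r IHr] u /=; first exact: BM.
by move=> [u1 u2]; split; apply: IHr.
Qed.

Lemma kinN r (u : koszul r) : kin B u -> kin B (- u).
Proof. by rewrite -scaleN1r; apply: kinZ. Qed.

Lemma kinZ_mem r c (u : koszul r) : B c -> kin B (c *: u).
Proof.
move=> Bc; elim: r u => [|r IHr] u /=; last by split; apply: IHr.
by rewrite /GRing.scale /= mulrC; apply: BM.
Qed.

Lemma kin_kdiff r (u : koszul r) : kin B u -> kin B (kdiff u).
Proof.
elim: r u => [|r IHr] u //= [u1 u2]; split; last by apply/kinN/IHr.
by apply: kinD; [apply: IHr|apply: kinZ].
Qed.

Lemma kin_kwedge be r (u : koszul r) : kin B u -> kin B (kwedge be u).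
Proof.
elim: r u => [|r IHr] u //= [u1 u2]; split; first exact: IHr.
by apply: kinD; [apply: kinZ|apply/kinN/IHr].
Qed.

End SubIdeal.

Lemma kin_sub (B B' : set O) r (u : koszul r) :
  B `<=` B' -> kin B u -> kin B' u.
Proof.
move=> BB'; elim: r u => [|r IHr] u /=; first exact: BB'.
by move=> [u1 u2]; split; apply: IHr.
Qed.

Lemma kterms_scale k c W t b r (z : koszul r) : whomog p t b ->
  kterms k c W z -> kterms k.+1 c.+1 (W + t) (b *: z).
Proof.
move=> hb; elim: r c W z => [|r IHr] c W z /=; last first.
  by move=> [z1 z2]; split; [apply: IHr|rewrite addrAC; apply: IHr].
move=> hz a; rewrite -mcoeff_msupp => /msuppM_le /allpairsP [[a1 a2] /=].
case=> a1b + ->; rewrite mcoeff_msupp => /hz [-> Wa].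
by split => //; rewrite weightD (hb _ a1b) addrC ltrD2l.
Qed.

Lemma ktermsD k c W r (u v : koszul r) :
  kterms k c W u -> kterms k c W v -> kterms k c W (u + v).
Proof.
elim: r c W u v => [|r IHr] c W u v /=; last first.
  by move=> [u1 u2] [v1 v2]; split; apply: IHr.
move=> hu hv a; rewrite mcoeffD.
by have [->|/hu //] := eqVneq u@_a 0; rewrite add0r => /hv.
Qed.

Lemma ktermsN k c W r (u : koszul r) : kterms k c W u -> kterms k c W (- u).
Proof.
elim: r c W u => [|r IHr] c W u /=; last by move=> [u1 u2]; split; apply: IHr.
by move=> hu a; rewrite mcoeffN oppr_eq0 => /hu.
Qed.

Lemma kterms_kwedge k c W s be r (z : koszul r) :
  (forall j, whomog p (s - d j) (be j)) ->
  kterms k c W z -> kterms k.+1 c (W + s) (kwedge be z).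
Proof.
move=> hbe; elim: r c W z => [|r IHr] c W z /=.
  by move=> _ a; rewrite mcoeff0 eqxx.
move=> [z1 z2]; split; first exact: IHr.
apply: ktermsD; first by rewrite -addrA; apply: kterms_scale.
by apply: ktermsN; rewrite addrAC; apply: IHr.
Qed.

Lemma kterms_high k c W r (z : koszul r) :
  kterms k c W z -> (c + r < k)%N -> z = 0.
Proof.
elim: r c W z => [|r IHr] c W z /=.
  move=> hz; rewrite addn0 => ck; apply/mpolyP => a; rewrite mcoeff0.
  by apply/eqP/negPn/negP => /hz [ck' _]; rewrite ck' ltnn in ck.
case: z => [z1 z2] /= [h1 h2]; rewrite addnS => ck.
rewrite (IHr _ _ _ h1) ?(IHr _ _ _ h2) ?addSn //.
exact: ltn_trans (ltnSn _) ck.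
Qed.

Lemma kterms_top k c W r (z : koszul r) :
  kterms k c W z -> (k <= c + r)%N -> (c + r <= k)%N ->
  kin [set h | forall a, h@_a != 0 -> W - \sum_(j < r) d j < weight p a] z.
Proof.
elim: r c W z => [|r IHr] c W z /=.
  by move=> hz _ _ a; rewrite big_ord0 subr0 => /hz [].
case: z => [z1 z2] /= [h1 h2]; rewrite addnS => ck kc; split.
  rewrite (kterms_high h1 kc); apply: kin0 => a.
  by rewrite mcoeff0 eqxx.
have := IHr _ _ _ h2; rewrite addSn => /(_ ck kc).
by rewrite big_ord_recr /= [_ + d r]addrC opprD addrA.
Qed.

Lemma kbase_kdiff r (z : koszul r) :
  exists a : 'I_r -> O, kbase (kdiff z) = \sum_j a j * F j.
Proof.
elim: r z => [|r IHr] z /=; first by exists (fun => 0); rewrite big_ord0.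
have [a ha] := IHr z.1.
exists (fun j => if unlift ord_max j is Some i then a i else kbase z.2).
have kbaseD (s : nat) (u v : koszul s) : kbase (u + v) = kbase u + kbase v.
  by elim: s u v => //= s IHs u v; rewrite IHs.
have kbaseZ (s : nat) b (u : koszul s) : kbase (b *: u) = b * kbase u.
  by elim: s u => //= s IHs u; rewrite IHs.
rewrite kbaseD kbaseZ big_ord_recr /= unlift_none mulrC; congr (_ + _).
rewrite ha; apply: eq_bigr => j _; congr (_ * _).
have -> : widen_ord (leqnSn r) j = fintype.lift ord_max j.
  by apply: val_inj; rewrite /= /bump leqNgt ltn_ord.
by rewrite liftK.
Qed.

Lemma kbase_kunit h r : kbase (kunit h r) = h.
Proof. by elim: r. Qed.

Lemma kdiff_kunit h r : kdiff (kunit h r) = 0.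
Proof. by elim: r => //= r ->; rewrite scaler0 addr0 (linear0 (@kdiff r)) oppr0. Qed.

Lemma kterms_kunit h W r : (forall a, h@_a != 0 -> W < weight p a) ->
  kterms 0 0 W (kunit h r).
Proof.
move=> hh; have kterms0 k c V s : kterms k c V (0 : koszul s).
  elim: s c V => [|s IHs] c V /=; last by split.
  by move=> a; rewrite mcoeff0 eqxx.
by elim: r => [|r IHr] /=; [move=> a /hh|split].
Qed.

(** The ideal generated by the [M]-th powers of the variables of index less
    than [k]. *)
Definition powers_ideal (M k : nat) : set O :=
  [set h | forall a, h@_a != 0 -> exists2 j : 'I_m, (j < k)%N & (M <= a j)%N].

Section PowersIdeal.
Variable M : nat.

Lemma powers_ideal0 k : powers_ideal M k 0.
Proof. by move=> a; rewrite mcoeff0 eqxx. Qed.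

Lemma powers_idealD k h h' :
  powers_ideal M k h -> powers_ideal M k h' -> powers_ideal M k (h + h').
Proof.
move=> hh hh' a; rewrite mcoeffD.
by have [->|/hh //] := eqVneq h@_a 0; rewrite add0r => /hh'.
Qed.

Lemma powers_idealM k c h : powers_ideal M k h -> powers_ideal M k (c * h).
Proof.
move=> hh a; rewrite -mcoeff_msupp => /msuppM_le /allpairsP [[a1 a2] /=].
rewrite !mcoeff_msupp => -[_ /hh [j jk Mj] ->]; exists j => //.
by rewrite mnmDE (leq_trans Mj) // leq_addl.
Qed.

Lemma powers_ideal_gen k (j : 'I_m) : (j < k)%N -> powers_ideal M k ('X_j ^+ M).
Proof.
move=> jk a; rewrite mpolyXn mcoeffX; case: (_ =P a) => [<- _|]; last by rewrite eqxx.
by exists j => //; rewrite mulmnE mnm1E eqxx mul1n.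
Qed.

Lemma powers_ideal_nzd (j : 'I_m) h :
  powers_ideal M j ('X_j ^+ M * h) -> powers_ideal M j h.
Proof.
move=> hh a ha; have := hh (U_(j) *+ M + a)%MM.
rewrite mulrC mpolyXn mcoeffMX => /(_ ha) [i ij Mi]; exists i => //.
by move: Mi; rewrite mnmDE mulmnE mnm1E eq_sym -val_eqE /= (ltn_eqF ij).
Qed.

Lemma powers_ideal_split (j : 'I_m) h : powers_ideal M j.+1 h ->
  exists v, powers_ideal M j (h - 'X_j ^+ M * v).
Proof.
move=> hh.
exists (\sum_(a <- msupp h | (M <= a j)%N) h@_a *: 'X_[a - U_(j) *+ M]).
rewrite mulr_sumr {1}(mpolyE h) (bigID (fun a : 'X_{1..m} => (M <= a j)%N)) /=.
rewrite [X in X + _ - _](eq_bigr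
  (fun a => 'X_j ^+ M * (h@_a *: 'X_[a - U_(j) *+ M]))); last first.
  move=> a Ma; rewrite -scalerAr mpolyXn -mpolyXD; congr (_ *: 'X_[_]).
  apply/mnmP => i; rewrite mnmDE mnmBE mulmnE mnm1E.
  by case: eqP => [<-|_]; rewrite ?mul0n ?subn0 // mul1n subnKC.
rewrite addrAC subrr add0r => b; rewrite raddf_sum /= => hb.
have /hasP [a ah /andP [Ma /andP [ha /eqP ab]]] :
    has (fun a : 'X_{1..m} => ~~ (M <= a j)%N && ((h@_a != 0) && (a == b))) (msupp h).
  apply: contraNT hb => /hasPn hn; rewrite big_seq_cond big1 // => a /andP [ah nMa].
  have := hn a ah; rewrite nMa /= mcoeffZ mcoeffX; case: (a == b) => /=.
    by rewrite andbT negbK => /eqP ->; rewrite mul0r.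
  by rewrite mulr0.
have [i ij Mi] := hh a ha; exists i; last by rewrite -ab.
rewrite ltnS leq_eqVlt in ij; case/orP: ij => // /eqP/val_inj ij.
by rewrite -ij Mi in Ma.
Qed.

Lemma kin_powers_nzd (j : 'I_m) r (u : koszul r) :
  kin (powers_ideal M j) ('X_j ^+ M *: u) -> kin (powers_ideal M j) u.
Proof.
elim: r u => [|r IHr] u /=; first exact: powers_ideal_nzd.
by move=> [u1 u2]; split; apply: IHr.
Qed.

Lemma kin_powers_split (j : 'I_m) r (u : koszul r) :
  kin (powers_ideal M j.+1) u ->
  exists v, kin (powers_ideal M j) (u - 'X_j ^+ M *: v).
Proof.
elim: r u => [|r IHr] u /=; first exact: powers_ideal_split.
by move=> [/IHr [v1 h1] /IHr [v2 h2]]; exists (v1, v2).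
Qed.

Lemma kin_powers_rel0 r (u : koszul r) : kin (powers_ideal M 0) u -> u = 0.
Proof.
elim: r u => [|r IHr] u /=; last first.
  by case: u => u1 u2 /= [/IHr -> /IHr ->].
move=> hu; apply/mpolyP => a; rewrite mcoeff0.
by apply/eqP/negPn/negP => /hu [].
Qed.

End PowersIdeal.

(** The socle degree of a weighted homogeneous complete intersection of
    dimension 0 is [\sum d - \sum p].  As [x_k ^+ M] belongs to the ideal [(F)],
    multiplication by it is null-homotopic on the Koszul complex [K] of [F].
    Since it is also injective modulo the [M]-th powers of the preceding
    variables, the connecting maps from the k.+1-st homology of [K] modulo the
    first k.+1 powers to the k-th homology modulo the first k powers are
    surjective.  So [O / (F)], the 0-th homology, is a quotient of the m-th
    homology modulo all the powers, with a shift of weights; and there the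
    large weights vanish, because every monomial of large weight is divisible
    by the [M]-th power of a variable. *)
Theorem high_weight_mem_ideal (M : nat) (be : 'I_m -> nat -> O) (h : O) :
  (forall j, 0 < p j) ->
  (forall j, 'X_j ^+ M = \sum_(l < m) be j l * F l) ->
  (forall j l, whomog p (M%:R * p j - d l) (be j l)) ->
  (forall a, h@_a != 0 -> \sum_(l < m) d l - \sum_j p j < weight p a) ->
  exists a : 'I_m -> O, h = \sum_l a l * F l.
Proof.
move=> p0 Xbe hbe hh.
pose W k := \sum_(l < m) d l - \sum_j p j + \sum_(j < m | (j < k)%N) M%:R * p j.
have main : forall k, (k <= m)%N -> forall z : koszul m,
    kterms k 0 (W k) z -> kin (powers_ideal M k) (kdiff z) ->
    exists w, kin (powers_ideal M k) (z - kdiff w).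
  move=> k; have [s] := ubnP (m - k); elim: s k => // s IHs k.
  rewrite ltnS leq_eqVlt => mk km z zt zd.
  have [km'|] := boolP (k == m); last first.
    move=> km'; have {km km'} km : (k < m)%N by rewrite ltn_neqAle km' km.
    pose j : 'I_m := Ordinal km.
    have [] := IHs k.+1 _ km (kwedge (be j) z).
    - by rewrite subnS prednK ?subn_gt0 // leq_eqVlt.
    - have -> : W k.+1 = W k + M%:R * p j.
        rewrite /W -[RHS]addrA; congr (_ + _).
        rewrite (bigD1 j) //= addrC; congr (_ + _); apply: eq_bigl => i.
        by rewrite ltnS leq_eqVlt -val_eqE /=; case: (ltngtP i k).
      exact: kterms_kwedge.
    - have -> : kdiff (kwedge (be j) z) =
          'X_j ^+ M *: z - kwedge (be j) (kdiff z).
        by rewrite Xbe -kdiff_kwedge addrK.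
      apply: kinD; first exact: powers_idealD.
        apply: kinZ_mem; first exact: powers_idealM.
        exact: powers_ideal_gen.
      apply: kinN; first exact: powers_idealM.
      apply: kin_kwedge;
        [exact: powers_ideal0|exact: powers_idealD|exact: powers_idealM|].
      by apply: kin_sub zd => a ha b /ha [i ik Mi]; exists i => //; apply: leqW.
    move=> w /(kin_powers_split (j := j)) [v hv]; exists v.
    apply: (@kin_powers_nzd M j).
    have -> : 'X_j ^+ M *: (z - kdiff v) =
        kdiff (kwedge (be j) z - kdiff w - 'X_j ^+ M *: v)
        + kwedge (be j) (kdiff z).
      rewrite !(raddfB (@kdiff m)) /= kdiffK subr0 linearZZ scalerBr.
      by rewrite [in RHS]addrAC kdiff_kwedge -Xbe.
    apply: kinD; first exact: powers_idealD.
      apply: kin_kdiff => //;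
        [exact: powers_ideal0|exact: powers_idealD|exact: powers_idealM].
    apply: kin_kwedge => //;
      [exact: powers_ideal0|exact: powers_idealD|exact: powers_idealM].
  rewrite (eqP km') in zt *; exists 0; rewrite linear0 subr0.
  apply: kin_sub (kterms_top zt _ _); rewrite ?add0n // => a ha b /ha.
  have -> : W m = \sum_(l < m) d l - \sum_j p j + \sum_j M%:R * p j.
    by rewrite /W; congr (_ + _); apply: eq_bigl => j; rewrite ltn_ord.
  rewrite addrAC (addrC (\sum_(l < m) d l)) addrK addrC => wb.
  have [/existsP [j Mj]|] := boolP [exists j : 'I_m, (M <= b j)%N].
    by exists j.
  rewrite negb_exists => /forallP nb; move: wb; rewrite ltNge => /negP [].
  rewrite lerBrDr -big_split /=; apply: ler_sum => j _.
  by rewrite -mulrSr -[_ *+ _.+1]mulr_natl ler_pM2r // ler_nat ltnNge.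
have [] := main 0%N (leq0n _) (kunit h m).
- apply: kterms_kunit => a /hh; suff -> : W 0%N = \sum_(l < m) d l - \sum_j p j by [].
  by rewrite /W [X in _ + X = _]big_pred0 ?addr0.
- by rewrite kdiff_kunit; apply: kin0; apply: powers_ideal0.
move=> w /kin_powers_rel0/eqP; rewrite subr_eq0 => /eqP hw.
by have := kbase_kdiff w; rewrite -hw kbase_kunit.
Qed.

End Koszul.
(** * Nonzerodivisors in reduced rings *)

Section ReducedRing.
Variables (O : comNzRingType) (n : nat) (g : 'I_n -> O).
Hypothesis rad : radical_ideal (ideal g).
Implicit Types (h x y : O) (S : set O).

Let msys h S := [/\ forall x y, S x -> S y -> S (x * y),
  forall x, S x -> ~ ideal g x & forall x, S x -> S 1 /\ S h].

(** The prime is the complement of a maximal multiplicative set containing [h]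
    and disjoint from the ideal.  By maximality, each element of the complement
    is killed modulo the ideal by some member of the set, which makes the
    complement a minimal prime; conversely an annihilator of [h] cannot lie in
    the set. *)
Lemma minimal_prime_annihilator h : ~ ideal g h ->
  exists2 P : {pred O}, minimal_prime_over (ideal g) P &
    forall x, ideal g (x * h) -> x \in P.
Proof.
move=> nIh.
have [F FP Ftot|A [[AM AI A1] Amax]] := @Zorn_bigcup O (msys h).
  split.
  - move=> x y [X FX Xx] [Y FY Yy].
    have [XY|YX] := Ftot _ _ FX FY; [exists Y => //|exists X => //].
      by have [cM _ _] := FP _ FY; apply: cM => //; apply: XY.
    by have [cM _ _] := FP _ FX; apply: cM => //; apply: YX.
  - by move=> x [X FX Xx]; have [_ cI _] := FP _ FX; apply: cI.
  - move=> x [X FX Xx]; have [_ _ c1] := FP _ FX.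
    by have [X1 Xh] := c1 _ Xx; split; exists X.
have powI k : ~ ideal g (h ^+ k) by move=> /rad.
have Ah : A 1 /\ A h.
  case: (pselect (exists x, A x)) => [[x /A1 //]|nA].
  case: (Amax [set h ^+ k | k in setT]); last split.
  - split; last first.
      by move=> s; case: nA; exists 1; apply: contrapT => nA1;
        have := s (h ^+ 0) (ex_intro2 _ _ 0%N I erefl).
    by move=> x Ax; case: nA; exists x.
  - by move=> _ _ [k _ <-] [l _ <-]; exists (k + l)%N; rewrite // exprD.
  - by move=> _ [k _ <-].
  - by move=> _ _; split; [exists 0%N|exists 1%N; rewrite // expr1].
have [A1' Ah'] := Ah.
(* Otherwise the multiplicative set generated by [A] and [x] contradicts the
   maximality of [A]. *)
have outA x : ~ A x -> exists2 s, A s & ideal g (s * x).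
  move=> nAx; apply: contrapT => nos.
  pose B := [set y | exists s k, A s /\ y = s * x ^+ k].
  apply: (Amax B).
    split; last first.
      by move=> BA; apply: nAx; apply: BA; exists 1, 1%N; rewrite mul1r expr1.
    by move=> s As; exists s, 0%N; rewrite expr0 mulr1.
  split.
  - move=> _ _ [s [k [As ->]]] [t [l [At ->]]]; exists (s * t), (k + l)%N.
    by rewrite exprD mulrACA; split => //; apply: AM.
  - move=> _ [s [k [As ->]]] hs; apply: nos; exists s => //.
    apply: (rad (k := k)); case: k hs => [|k] hs.
      by case: (AI s As); rewrite expr0 mulr1 in hs.
    by rewrite exprMn [s ^+ _]exprSr -mulrA; apply: idealMl.
  - move=> _ _; split; [exists 1, 0%N|exists h, 0%N]; rewrite expr0 ?mulr1 //.
pose P : {pred O} := [pred x | `[< ~ A x >]].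
have PE x : (x \in P) <-> ~ A x by split => [/asboolP|nA]; last exact/asboolP.
have killP s x : A s -> ideal g (s * x) -> x \in P.
  by move=> As sx; apply/PE => Ax; apply: (AI _ (AM _ _ As Ax)).
have Pprime : prime_over (ideal g) P.
  split.
  - split; first by apply: (killP 1) => //; rewrite mulr0; apply: ideal0.
      by apply/negP => /PE.
    move=> a u v /PE/outA [s As su] /PE/outA [t At tv].
    apply: (killP (s * t)); first exact: AM.
    rewrite mulrDr; apply: idealD; last by rewrite -mulrA; apply: idealMl.
    by rewrite [s * t]mulrC mulrACA; apply: idealMl.
  - move=> u v /PE nuv; apply/orP; apply: contrapT => /not_orP [nu nv].
    by apply: nuv; apply: AM; apply: contrapT => /PE.
  - by move=> x Ix; apply: (killP 1); rewrite ?mul1r.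
exists P; last first.
  by move=> x; rewrite mulrC => hx; apply: killP hx.
split => // Q [Qid Qprime QI] QP x; apply/idP/idP; first exact: QP.
move=> /PE/outA [s As /QI /Qprime /orP [/QP/PE //|//]].
Qed.

Lemma nonzerodivisor_of_minimal_primes x h :
  (forall P, minimal_prime_over (ideal g) P -> x \notin P) ->
  ideal g (x * h) -> ideal g h.
Proof.
move=> hx xh; apply: contrapT => /minimal_prime_annihilator [P /hx nP].
by move=> /(_ x xh) xP; rewrite xP in nP.
Qed.

End ReducedRing.
(** * The Jacobian determinant as a derivation *)

Section Jacobian.
Variables (C : numFieldType) (n : nat) (g : 'I_n -> {mpoly C[n.+1]}).
Local Notation O := {mpoly C[n.+1]}.
Implicit Types h k : O.

Let jacmx h : 'M[O]_n.+1 :=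
  \matrix_(i, j) mderiv j (if unlift ord0 i is Some k then g k else h).

(** The vector field [\sum_j jac_minor j * mderiv j], tangent to the fibres
    of [g], is [jac g]. *)
Definition jac_minor (j : 'I_n.+1) : O := cofactor (jacmx 0) ord0 j.

Lemma cofactor_jacmx h j : cofactor (jacmx h) ord0 j = jac_minor j.
Proof.
congr (_ * \det _); apply/matrixP => i l; rewrite !mxE.
by rewrite liftK.
Qed.

Lemma jacE h : jac g h = \sum_j mderiv j h * jac_minor j.
Proof.
rewrite /jac (expand_det_row _ ord0); apply: eq_bigr => j _.
by rewrite mxE unlift_none -(cofactor_jacmx h).
Qed.

Lemma jac_is_linear : linear (jac g).
Proof.
move=> c h k; rewrite !jacE scaler_sumr -big_split; apply: eq_bigr => j _ /=.
by rewrite linearP mulrDl scalerAl.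
Qed.

HB.instance Definition _ :=
  GRing.isLinear.Build C O O _ (jac g) jac_is_linear.

Lemma jacM h k : jac g (h * k) = h * jac g k + jac g h * k.
Proof.
rewrite !jacE mulr_sumr mulr_suml -big_split; apply: eq_bigr => j _ /=.
rewrite mderivM mulrDl [RHS]addrC; congr (_ + _); first exact: mulrAC.
exact/esym/mulrA.
Qed.

Lemma jac_gen i : jac g (g i) = 0.
Proof.
apply: (@determinant_alternate _ _ _ ord0 (fintype.lift ord0 i)) => // j.
by rewrite !mxE unlift_none liftK.
Qed.

Lemma jac_mul_gen h i : jac g (g i * h) = g i * jac g h.
Proof. by rewrite jacM jac_gen mul0r addr0. Qed.

Lemma jac_ideal h : ideal g h -> ideal g (jac g h).
Proof.
move=> [a ->]; rewrite linear_sum; apply: ideal_sum => i _ /=.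
by rewrite mulrC jac_mul_gen; apply/idealMr/ideal_gen.
Qed.

Variables (p : 'I_n.+1 -> rat) (e : 'I_n -> rat) (f : O).
Hypothesis g_homog : forall i, whomog p (e i) (g i).
Hypothesis f_homog : whomog p 1 f.

Lemma jac_homog d h : whomog p d h ->
  whomog p (d + \sum_i e i - \sum_j p j) (jac g h).
Proof.
move=> hh.
pose D i := if unlift ord0 i is Some k then e k else d.
have -> : d + \sum_i e i = \sum_i D i.
  rewrite big_ord_recl /D unlift_none; congr (_ + _).
  by apply: eq_bigr => i _; rewrite liftK.
apply: whomog_det => i j; rewrite mxE /D.
by case: unliftP => [k _|_]; apply: whomog_mderiv.
Qed.

(** Contracting the two-form [dh /\ df], which vanishes on the curve [g = 0],
    with the Euler field gives [f dh = (deg h) h df].  In coordinates: the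
    Jacobian matrix of [(f, g)] maps the Euler field to [(f, e_i g_i)], so its
    adjugate shows that [f] times the minor [jac_minor j] is [p_j x_j J] modulo
    [I], which is substituted in the expansion of [f * jac g h]. *)
Lemma mul_jac_euler d h : whomog p d h ->
  ideal g (f * jac g h - ratr d *: (h * jac g f)).
Proof.
move=> hh; pose xi : 'cV[O]_n.+1 := \col_j (ratr (p j) *: 'X_j).
have rowE d' k i : whomog p d' k -> (forall j, jacmx f i j = mderiv j k) ->
    (jacmx f *m xi) i 0 = ratr d' *: k.
  move=> hk rk; rewrite -(euler_identity hk) mxE; apply: eq_bigr => j _.
  by rewrite rk mulrC [xi _ _]mxE.
have minorE j : ideal g (xi j 0 * jac g f - f * jac_minor j).
  have -> : xi j 0 * jac g f = (\adj (jacmx f) *m (jacmx f *m xi)) j 0.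
    by rewrite mulmxA mul_adj_mx mul_scalar_mx [RHS]mxE mulrC.
  rewrite mxE big_ord_recl mxE cofactor_jacmx.
  rewrite (rowE 1 f) //; last by move=> l; rewrite mxE unlift_none.
  rewrite rmorph1 scale1r mulrC addrAC subrr add0r.
  apply: ideal_sum => i _; rewrite (rowE (e i) (g i)) //; last first.
    by move=> l; rewrite mxE liftK.
  by rewrite -scalerAr -mul_mpolyC; apply/idealMl/idealMl/ideal_gen.
rewrite scalerAl -(euler_identity hh) jacE mulr_sumr mulr_suml -sumrB.
apply: ideal_sum => j _.
have -> : f * (mderiv j h * jac_minor j) -
    ratr (p j) *: 'X_j * mderiv j h * jac g f =
    - (mderiv j h * (xi j 0 * jac g f - f * jac_minor j)).
  rewrite mulrBr opprB [xi _ _]mxE mulrCA; congr (_ - _).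
  by rewrite mulrCA mulrA.
exact/idealN/idealMl.
Qed.

End Jacobian.
(** * Laurent polynomials of forms and the Gauss-Manin relations *)

Section LaurentForms.
Variables (C : numFieldType) (n : nat).
Local Notation O := {mpoly C[n.+1]}.
Local Notation M := {freeg int / O}.
Local Notation L := (laurent C n).
Implicit Types (u v : L) (a : M) (j k l : int) (h : O).

Lemma laurentP u v : (forall k, coeff k u = coeff k v) -> u = v.
Proof. by move=> uv; apply/eqP/freeg_eqP. Qed.

Lemma coeff_laurentD k u v : coeff k (u + v) = coeff k u + coeff k v.
Proof. exact: coeffD. Qed.

Lemma coeff_laurentB k u v : coeff k (u - v) = coeff k u - coeff k v.
Proof. exact: coeffB. Qed.

Lemma coeff_laurentZ k (c : C) u : coeff k (c *: u) = c *: coeff k u.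
Proof. by rewrite -mul_mpolyC; apply: coeffZ. Qed.

Lemma coeff_laurent_sum k (I : Type) (r : seq I) (P : pred I) (F : I -> L) :
  coeff k (\sum_(i <- r | P i) F i) = \sum_(i <- r | P i) coeff k (F i).
Proof. exact: (raddf_sum (@coeff O int k)). Qed.

Lemma coeff_alpha_form k h : coeff k (alpha_form h) = h * (k == 0)%:R.
Proof. by rewrite /alpha_form coeffU eq_sym. Qed.

Lemma sum_dom_delta (G : O -> O) a j : G 0 = 0 ->
  \sum_(k <- dom a) G (coeff k a) * (k == j)%:R = G (coeff j a).
Proof.
move=> G0; have [ja|nja] := boolP (j \in dom a).
  rewrite (bigD1_seq j) ?uniq_dom //= eqxx mulr1 big1 ?addr0 // => k kj.
  by rewrite (negPf kj) mulr0.
rewrite coeff_outdom // G0 big_seq big1 // => k ka.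
by case: eqP => [kj|]; rewrite ?mulr0 //; rewrite -kj ka in nja.
Qed.

Lemma coeff_tau j k u : coeff j (tau k u) = coeff (j - k) u.
Proof.
rewrite /tau fglift_sum raddf_sum /= -(sum_dom_delta u (G := id)) //.
apply: eq_bigr => l _; rewrite coeffZ coeffU mul1r.
by rewrite [l == _]eq_sym subr_eq eq_sym.
Qed.

Lemma coeff_dtau f j u :
  coeff j (dtau f u) = (j + 1)%:~R * coeff (j + 1) u - f * coeff j u.
Proof.
rewrite /dtau fglift_sum raddf_sum /=.
rewrite -(sum_dom_delta u j (G := fun h => f * h)) ?mulr0 //.
rewrite -(sum_dom_delta u (j + 1) (G := fun h => (j + 1)%:~R * h)) ?mulr0 //.
rewrite -sumrB; apply: eq_bigr => l _; rewrite coeffZ coeffB !coeffU.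
rewrite mulrBr [coeff l u * (f * _)]mulrA [_ * f]mulrC; congr (_ - _).
rewrite subr_eq; case: eqP => [->|_]; last by rewrite !mulr0.
by rewrite !mulr1 mulrC.
Qed.

(** The operator [tau d_tau] of the Gauss-Manin system. *)
Definition euler_op f u : L := tau 1 (dtau f u).

Lemma coeff_euler_op f j u :
  coeff j (euler_op f u) = j%:~R * coeff j u - f * coeff (j - 1) u.
Proof. by rewrite coeff_tau coeff_dtau subrK. Qed.

Lemma tau_is_linear k : linear (@tau C n k).
Proof.
move=> c u v; apply: laurentP => j.
by rewrite coeff_tau !(coeff_laurentD, coeff_laurentZ, coeff_tau).
Qed.

HB.instance Definition _ k :=
  GRing.isLinear.Build C L L _ (@tau C n k) (@tau_is_linear k).

Lemma tauD k l u : tau k (tau l u) = tau (k + l) u.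
Proof. by apply: laurentP => j; rewrite !coeff_tau opprD addrA. Qed.

Lemma tau0 u : tau 0 u = u.
Proof. by apply: laurentP => j; rewrite coeff_tau subr0. Qed.

Lemma tauK k u : tau (- k) (tau k u) = u.
Proof. by rewrite tauD addNr tau0. Qed.

Lemma euler_op_is_linear f : linear (euler_op f).
Proof.
move=> c u v; apply: laurentP => j.
rewrite !(coeff_laurentD, coeff_laurentZ, coeff_euler_op).
by rewrite !mulrDr -!scalerAr scalerBr opprD addrACA.
Qed.

HB.instance Definition _ f :=
  GRing.isLinear.Build C L L _ (euler_op f) (euler_op_is_linear f).

Lemma euler_op_tau f k u :
  euler_op f (tau k u) = tau k (euler_op f u + k%:~R *: u).
Proof.
apply: laurentP => j.
rewrite !(coeff_euler_op, coeff_tau, coeff_laurentD, coeff_laurentZ).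
rewrite -mul_mpolyC rmorph_int [RHS]addrAC -mulrDl -rmorphD /= subrK.
by rewrite [j - 1 - k]addrAC.
Qed.

Lemma euler_op_alpha_form f h :
  euler_op f (alpha_form h) = tau 1 (alpha_form (- f * h)).
Proof.
apply: laurentP => j.
rewrite coeff_euler_op coeff_tau !coeff_alpha_form mulNr.
case: (eqVneq j 0) => [->|_]; first by rewrite mul0r sub0r mulrA mulNr.
by rewrite !mulr0 sub0r mulrA mulNr.
Qed.

Lemma alpha_form_is_linear : linear (@alpha_form C n).
Proof.
move=> c h k; apply: laurentP => j.
by rewrite !(coeff_laurentD, coeff_laurentZ, coeff_alpha_form) mulrDl scalerAl.
Qed.

HB.instance Definition _ := GRing.isLinear.Build C O L _ (@alpha_form C n)
  alpha_form_is_linear.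

Lemma laurent_sum_tau u :
  u = \sum_(k <- dom (u : M)) tau k (alpha_form (coeff k u)).
Proof.
apply: laurentP => j; rewrite coeff_laurent_sum.
rewrite -[LHS](sum_dom_delta u (G := id)) //; apply: eq_bigr => k _.
by rewrite coeff_tau coeff_alpha_form subr_eq0 eq_sym.
Qed.

End LaurentForms.

Section Relations.
Variables (C : numFieldType) (n : nat).
Local Notation O := {mpoly C[n.+1]}.
Local Notation M := {freeg int / O}.
Local Notation L := (laurent C n).
Variables (g : 'I_n -> O) (f : O).
Local Notation I := (ideal g).
Local Notation J := (jac g f).
Local Notation rel := (GM0_rel g f).
Implicit Types (u v : L) (a : M) (j k l : int) (h : O).

Lemma coeff_twisted_d j a :
  coeff j (twisted_d g f a) = jac g (coeff j a) - coeff (j - 1) a * J.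
Proof.
rewrite /twisted_d coeff_laurent_sum.
rewrite -(sum_dom_delta a j (G := jac g)) ?linear0 //.
rewrite -(sum_dom_delta a (j - 1) (G := fun h => h * J)) ?mul0r //.
rewrite -sumrB; apply: eq_bigr => k _; rewrite coeffB !coeffU.
by rewrite [k == j - 1]eq_sym subr_eq [j == _]eq_sym.
Qed.

(** The [b i] in [GM0_rel] can be chosen separately for each power of [tau], so
    that only congruences modulo [I] between coefficients remain. *)
Lemma GM0_relP u : rel u <-> exists a : M, forall j,
  I (coeff j u - (jac g (coeff j a) - coeff (j - 1) a * J)).
Proof.
split=> [[_ [a _ <-] [b ->]]|[a ha]].
  exists a => j; rewrite coeffD coeff_twisted_d raddf_sum /= addrC addKr.
  by apply: ideal_sum => i _; rewrite coeffZ; apply/idealMr/ideal_gen.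
have /choice [c hc] : forall j, exists c : 'I_n -> O,
    coeff j (u - twisted_d g f a) = \sum_i c i * g i.
  move=> j; have [c hc] := ha j; exists c.
  by rewrite coeff_laurentB coeff_twisted_d.
exists (twisted_d g f a); first by exists a.
exists (fun i => \sum_(k <- dom (u - twisted_d g f a : M)) << c k i *g k >>).
apply/eqP/freeg_eqP => j.
rewrite coeffD [X in _ + X]raddf_sum /=.
rewrite -[LHS](subrK (coeff j (twisted_d g f a))) [RHS]addrC; congr (_ + _).
rewrite -coeffB.
have [jd|njd] := boolP (j \in dom (u - twisted_d g f a : M)).
  rewrite [LHS](hc j); apply: eq_bigr => i _.
  rewrite coeffZ mulrC raddf_sum (bigD1_seq j) ?uniq_dom //=.
  rewrite coeffU eqxx mulr1 big1 ?addr0 // => k kj.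
  by rewrite coeffU (negPf kj) mulr0.
rewrite (coeff_outdom njd) big1 // => i _; rewrite coeffZ raddf_sum /=.
rewrite big_seq big1 ?mulr0 // => k kd; rewrite coeffU.
by case: eqP => [kj|]; rewrite ?mulr0 //; rewrite -kj kd in njd.
Qed.

Lemma GM0_rel_subspace : subspace rel.
Proof.
split.
  apply/GM0_relP; exists 0 => j.
  by rewrite !coeff0 linear0 mul0r !subr0; apply: ideal0.
move=> c u v /GM0_relP [a ha] /GM0_relP [b hb]; apply/GM0_relP.
exists (c *: (a : L) + (b : L)) => j.
rewrite !(coeff_laurentD, coeff_laurentZ) linearP mulrDl -scalerAl.
have regroup (R : comNzRingType) (x y z t x' y' : R) :
    x + y - (z + t - (x' + y')) = x - (z - x') + (y - (t - y')) by ring.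
rewrite regroup -!scalerBr; exact: (proj2 (ideal_subspace g)).
Qed.

Lemma GM0_rel_tau k u : rel u -> rel (tau k u).
Proof.
move=> /GM0_relP [a ha]; apply/GM0_relP; exists (tau k (a : L)) => j.
by rewrite !coeff_tau [j - 1 - k]addrAC.
Qed.

(** [tau d_tau] commutes with [d - tau df] when it acts on functions by the same
    formula as on forms. *)
Lemma GM0_rel_euler_op u : rel u -> rel (euler_op f u).
Proof.
move=> /GM0_relP [a ha]; apply/GM0_relP; exists (euler_op f (a : L)) => j.
rewrite !coeff_euler_op.
pose r i := coeff i u - (jac g (coeff i a) - coeff (i - 1) a * J).
suff -> : j%:~R * coeff j u - f * coeff (j - 1) u -
    (jac g (j%:~R * coeff j a - f * coeff (j - 1) a) -
     ((j - 1)%:~R * coeff (j - 1) a - f * coeff (j - 1 - 1) a) * J) =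
    j%:~R * r j - f * r (j - 1).
  by apply: idealB; apply: idealMl; apply: ha.
rewrite /r.
have jac_int h : jac g (j%:~R * h) = j%:~R * jac g h.
  by rewrite !mulrzl (raddfMz (jac g)).
have jacB h h' : jac g (h - h') = jac g h - jac g h' by exact: raddfB.
rewrite jacB (jac_int (coeff j a)) jacM intrB.
have regroup (R : comNzRingType) (z x u0 u1 A0 A1 a1 a2 y : R) :
    z * u0 - x * u1 -
      (z * A0 - (x * A1 + y * a1) - ((z - 1) * a1 - x * a2) * y) =
    z * (u0 - (A0 - a1 * y)) - x * (u1 - (A1 - a2 * y)) by ring.
exact: regroup.
Qed.

End Relations.
(** * Properties of a Malgrange-Kashiwara filtration *)

Section FiltrationFacts.
Variables (C : numFieldType) (n : nat).
Local Notation O := {mpoly C[n.+1]}.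
Local Notation L := (laurent C n).
Variables (g : 'I_n -> O) (f : O) (V : rat -> set L).
Local Notation rel := (GM0_rel g f).
Hypothesis V_MK : MK_filtration g f V.
Implicit Types (u v x : L) (q r : {poly C}) (s t : seq L).

Lemma MK_subspace l : subspace (V l).
Proof.
have [V0 Vlin] := MK_submod V_MK l.
split=> [|c u v Vu Vv]; first exact: (set_mem V0).
by apply: set_mem; apply: Vlin; apply: mem_set.
Qed.

Lemma MK_tau1 l u : V l u -> V (l - 1) (tau 1 u).
Proof. by move=> Vu; rewrite -(MK_tau V_MK); exists u. Qed.

Lemma MK_tau_inv (k : nat) l u : V (l - k%:R) u -> V l (tau (- k%:Z) u).
Proof.
elim: k u => [|k IHk] u; first by rewrite subr0 tau0.
rewrite -natr1 opprD addrA -(MK_tau V_MK) => -[v /IHk Vv <-].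
by rewrite tauD -addn1 PoszD opprD addrNK.
Qed.

Lemma MK_euler_op l u : V l u -> V l (euler_op f u).
Proof.
move=> Vu; rewrite -[l](addrK 1); apply: MK_tau1.
by apply: (MK_dtau V_MK); exists u.
Qed.

Lemma common_denominator (A : seq rat) : exists2 d : nat, (0 < d)%N &
  {in A, forall a, exists z : int, a = z%:~R / d%:R}.
Proof.
elim: A => [|a A [d d0 hd]]; first by exists 1%N.
have d0' : d%:R != 0 :> rat by rewrite pnatr_eq0 -lt0n.
have b0 : (0 < absz (denq a))%N by rewrite absz_gt0 denq_eq0.
have b0' : (absz (denq a))%:R != 0 :> rat by rewrite pnatr_eq0 -lt0n.
exists (d * absz (denq a))%N; first by rewrite muln_gt0 d0.
move=> c; rewrite inE natrM => /orP [/eqP ->|/hd [z ->]].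
  exists (numq a * d%:Z); rewrite -[a in LHS]divq_num_den.
  have -> : (denq a)%:~R = (absz (denq a))%:R :> rat.
    by rewrite -[in LHS](absz_denq a).
  by rewrite rmorphM /=; field; apply/andP.
exists (z * (absz (denq a))%:Z); rewrite rmorphM /=; field.
by rewrite d0' b0'.
Qed.

Lemma MK_jumps : exists2 d : nat, (0 < d)%N &
  forall l, exists2 z : int, z%:~R / d%:R <= l & V l = V (z%:~R / d%:R).
Proof.
have [A [_ hA]] := MK_discrete V_MK.
have [d d0 hd] := common_denominator A; exists d => // l.
have d0' : d%:R != 0 :> rat by rewrite pnatr_eq0 -lt0n.
have [l' [[a aA [z l'E]] l'l _ Vl]] := hA l.
have [b ab] := hd a aA.
suff l'E' : l' = (b + z * d%:Z)%:~R / d%:R.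
  by exists (b + z * d%:Z); rewrite -l'E'.
by rewrite l'E ab rmorphD rmorphM /=; field.
Qed.

Lemma polytau_wide q u (m : nat) : (size q <= m)%N ->
  polytau q u = \sum_(j < m) q`_j *: tau j%:Z u.
Proof.
move=> qm; rewrite /polytau (big_ord_widen m (fun j => q`_j *: tau j%:Z u)) //.
rewrite big_mkcond; apply: eq_bigr => j _; case: ltnP => // qj.
by rewrite nth_default // scale0r.
Qed.

Lemma polytauB q r u : polytau (q - r) u = polytau q u - polytau r u.
Proof.
pose m := maxn (size q) (size r).
rewrite !(@polytau_wide _ _ m) ?leq_maxl ?leq_maxr //; last first.
  by rewrite (leq_trans (size_polyD _ _)) // size_polyN.
rewrite -sumrB; apply: eq_bigr => j _.
by rewrite coefB scalerBl.
Qed.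

Lemma polytau0 u : polytau 0 u = 0.
Proof. by rewrite -[0 in LHS](subrr 0) polytauB subrr. Qed.

Lemma polytauMn q (m : nat) u : polytau (q *+ m) u = polytau q u *+ m.
Proof.
elim: m => [|m IHm]; first exact: polytau0.
rewrite !mulrSr -IHm -[X in polytau (_ + X)]opprK polytauB; congr (_ + _).
by rewrite -[- q]sub0r polytauB polytau0 sub0r opprK.
Qed.

Lemma tau_polytau (m : nat) q u :
  tau m%:Z (polytau q u) = polytau (q * 'X^m) u.
Proof.
rewrite (@polytau_wide (q * 'X^m) u (m + size q)); last first.
  have [->|q0] := eqVneq q 0; first by rewrite mul0r size_poly0.
  by rewrite size_mulXn.
rewrite big_split_ord /= big1 ?add0r => [|j _]; last first.
  by rewrite coefMXn ltn_ord scale0r.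
rewrite linear_sum; apply: eq_bigr => j _ /=.
by rewrite linearZZ /= tauD coefMXn ltnNge leq_addr /= addKn.
Qed.

Lemma sum_count (s t : seq L) (F : L -> L) : uniq t -> {subset s <= t} ->
  \sum_(x <- s) F x = \sum_(x <- t) F x *+ count_mem x s.
Proof.
move=> tu; elim: s => [|x s IHs] st; first by rewrite big_nil big1.
rewrite big_cons IHs => [|y ys]; last by apply: st; rewrite inE ys orbT.
rewrite [RHS](eq_bigr (fun y => F y *+ (x == y) + F y *+ count_mem y s));
  last by move=> y _; rewrite /= mulrnDr.
rewrite big_split; congr (_ + _) => /=.
rewrite (bigD1_seq x) ?st ?inE ?eqxx //= big1 ?addr0 // => y yx.
by rewrite eq_sym (negPf yx).
Qed.

(** The filtration is separated: coordinates over [C[tau]] of an element of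
    [V l] which lies in all [V (l - k) = tau ^ k V l] are divisible by all
    powers of [tau]. *)
Lemma MK_separated l u : (forall k : nat, V (l - k%:R) u) -> rel u.
Proof.
move=> Vu; have relS := GM0_rel_subspace g f.
have [S [SV span ind]] := MK_free V_MK l.
have [|s [q [sS hs]]] := span u; first by have := Vu 0%N; rewrite subr0.
pose K := \max_(x <- s) size (q x).
have [t [r [tS ht]]] := span _ (MK_tau_inv (Vu K)).
pose z := undup (s ++ t).
have zu : uniq z by apply: undup_uniq.
have zS x : x \in z -> S x.
  by rewrite mem_undup mem_cat => /orP [/sS|/tS].
pose Q x := q x *+ count_mem x s.
pose T x := (r x *+ count_mem x t) * 'X^K.
have sumQ : \sum_(x <- s) polytau (q x) x = \sum_(x <- z) polytau (Q x) x.
  rewrite (sum_count _ zu) => [|x xs]; last by rewrite mem_undup mem_cat xs.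
  by apply: eq_bigr => x _; rewrite polytauMn.
have sumT : tau K%:Z (\sum_(x <- t) polytau (r x) x) =
    \sum_(x <- z) polytau (T x) x.
  rewrite linear_sum (sum_count _ zu) => [|x xt]; last first.
    by rewrite mem_undup mem_cat xt orbT.
  apply: eq_bigr => x _ /=.
  by rewrite tau_polytau -polytauMn /T mulrnAl.
have QT x : x \in z -> Q x - T x = 0.
  apply: (ind z (fun x => Q x - T x)) => //.
  under eq_bigr => y _ do rewrite polytauB.
  rewrite sumrB -sumQ -sumT.
  have {}ht := GM0_rel_tau K ht; rewrite linearB /= tauD subrr tau0 in ht.
  have -> : \sum_(x <- s) polytau (q x) x -
      tau K%:Z (\sum_(x <- t) polytau (r x) x) =
      (u - tau K%:Z (\sum_(x <- t) polytau (r x) x)) -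
      (u - \sum_(x <- s) polytau (q x) x).
    by rewrite opprB [RHS]addrC addrA subrK.
  exact: subspaceB.
have Q0 x : x \in s -> Q x = 0.
  move=> xs; have /QT/eqP : x \in z by rewrite mem_undup mem_cat xs.
  rewrite subr_eq0 => /eqP QTx; apply/polyP => j; rewrite coef0.
  have [jK|Kj] := ltnP j K; first by rewrite QTx coefMXn jK.
  rewrite coefMn nth_default ?mul0rn //; apply: leq_trans Kj.
  by rewrite /K (big_rem x) //= leq_maxl.
suff <- : u - \sum_(x <- s) polytau (q x) x = u by [].
rewrite sumQ big_seq big1 ?subr0 // => x _.
have [xs|nxs] := boolP (x \in s); first by rewrite Q0 // polytau0.
by rewrite /Q (count_memPn nxs) mulr0n polytau0.
Qed.

End FiltrationFacts.
(** * Jordan strings of multiplication by [- f] *)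

Section JordanStrings.
Variables (C : numFieldType) (n : nat).
Local Notation O := {mpoly C[n.+1]}.
Variables (p : 'I_n.+1 -> rat) (e : 'I_n -> rat) (g : 'I_n -> O) (f : O).
Variables (mu2 : nat) (N : 'I_mu2 -> nat) (w : 'I_mu2 -> O) (dimf : nat).
Hypothesis p_gt0 : forall i, 0 < p i.
Hypothesis g_homog : forall i, whomog p (e i) (g i).
Hypothesis f_homog : whomog p 1 f.
Hypothesis rad : radical_ideal (ideal g).
Hypothesis f_branches : nonconstant_on_branches g f.
Hypothesis f_finite : quot_dim (V := O) setT (ideal_adjoin (ideal g) f) dimf.
Hypothesis jordan : homog_jordan_basis p g f N w.

Local Notation I := (ideal g).
Local Notation J := (jac g f).
Local Notation df := (df_omega g f).
Local Notation om := (omega f w).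
Local Notation nuo := (nu p e).
Implicit Types (h : O) (i : 'I_mu2) (j : nat).

Lemma f_nonzerodivisor h : I (f * h) -> I h.
Proof.
apply: nonzerodivisor_of_minimal_primes => // P hP.
by have := f_branches hP 0; rewrite mpolyC0 subr0.
Qed.

Lemma ideal_adjoin_mul x h k :
  ideal_adjoin I x h -> ideal_adjoin I x (k * h).
Proof.
by move=> [a ha]; exists (k * a); rewrite -mulrA -mulrBr; apply: idealMl.
Qed.

Lemma ideal_adjoin_wcomp x s d h : whomog p s x ->
  ideal_adjoin I x h -> ideal_adjoin I x (wcomp p d h).
Proof.
move=> hx [a ha]; exists (wcomp p (d - s) a).
by rewrite -(wcompM _ _ hx) -linearB; apply: ideal_wcomp g_homog _.
Qed.

(** A linear relation between the powers of a variable modulo a homogeneous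
    ideal involves only powers that lie in the ideal, as they have different
    weights. *)
Lemma variable_power_mem :
  exists M, forall j : 'I_n.+1, ideal_adjoin I f ('X_j ^+ M).
Proof.
exists dimf => l; have [v hv] := f_finite.
have [c [[t ct] hc]] := quot_span_dependent (ideal_adjoin_subspace g f) hv
  (ltnSn dimf) (u := fun t => 'X_l ^+ t) (fun=> Logic.I).
have homX s : whomog p (s%:R * p l) ('X_l ^+ s : O).
  by apply: whomog_exp; rewrite -weightU; apply: whomogX.
have := ideal_adjoin_wcomp (t%:R * p l) f_homog hc.
rewrite linear_sum (bigD1 t) //= big1 ?addr0 => [|s st]; last first.
  rewrite linearZZ /= (wcomp_neq (homX s)) ?scaler0 //.
  by rewrite (inj_eq (mulIf (lt0r_neq0 (p_gt0 l)))) eqr_nat.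
rewrite linearZZ /= (wcomp_id (homX t)).
move=> /(ideal_adjoin_mul ((c t)^-1%:MP * 'X_l ^+ (dimf - t))).
by rewrite -mul_mpolyC mulrACA -mpolyCM mulVf // mul1r -exprD subnK // -ltnS.
Qed.

Lemma high_weight_mem h :
  (forall a, h@_a != 0 -> 1 + \sum_i e i - \sum_k p k < weight p a) ->
  ideal_adjoin I f h.
Proof.
move=> hh; have [M hM] := variable_power_mem.
pose F (k : 'I_n.+1) := if unlift ord0 k is Some l then g l else f.
pose d (k : 'I_n.+1) := if unlift ord0 k is Some l then e l else 1.
have hF k : whomog p (d k) (F k) by rewrite /d /F; case: (unlift _ _).
have memF x : ideal_adjoin I f x <-> exists a : 'I_n.+1 -> O,
    x = \sum_k a k * F k.
  split=> [[b [a /eqP]]|[a ->]].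
    rewrite subr_eq => /eqP ->.
    exists (fun k => if unlift ord0 k is Some l then a l else b).
    rewrite big_ord_recl /F unlift_none addrC; congr (_ + _).
    by apply: eq_bigr => k _; rewrite liftK.
  exists (a ord0); rewrite big_ord_recl /F unlift_none addrAC subrr add0r.
  apply: ideal_sum => k _; rewrite liftK; exact/idealMl/ideal_gen.
have /choice [be hbe] : forall j : 'I_n.+1, exists b : 'I_n.+1 -> O,
    'X_j ^+ M = \sum_k b k * F k by move=> j; apply/memF.
apply/memF.
have [] := @high_weight_mem_ideal C n.+1 p (fun k => F (inord k))
  (fun k => d (inord k)) M
  (fun l k => wcomp p (M%:R * p l - d (inord k)) (be l (inord k))) h p_gt0.
- move=> l.
  have homX : whomog p (M%:R * p l) ('X_l ^+ M : O).
    by apply: whomog_exp; rewrite -weightU; apply: whomogX.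
  rewrite -[LHS](wcomp_id homX) hbe linear_sum; apply: eq_bigr => k _ /=.
  by rewrite (wcompM _ _ (hF k)) inord_val.
- by move=> k l; apply: wcomp_homog.
- suff -> : \sum_(l < n.+1) d (inord l) = 1 + \sum_k e k by [].
  rewrite (eq_bigr d) => [|k _]; last by rewrite inord_val.
  rewrite big_ord_recl {1}/d unlift_none; congr (_ + _).
  by apply: eq_bigr => k _; rewrite /d liftK.
move=> a ->; exists a; apply: eq_bigr => k _; by rewrite inord_val.
Qed.

Lemma omega_succ i j : om i j.+1 = - f * om i j.
Proof. by rewrite /omega exprS mulrA. Qed.

Lemma omega_notin i (j : 'I_(N i).+1) : ~ df (om i j).
Proof.
have [_ [_ _ ind] _] := jordan => hj.
pose x0 : jidx N := Tagged _ j.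
suff /eqP : (x0 == x0)%:R = 0 :> C by rewrite eqxx oner_eq0.
apply: (ind (fun x => (x == x0)%:R)).
rewrite (bigD1 x0) //= eqxx scale1r big1 ?addr0 //.
by move=> x /negPf ->; rewrite scale0r.
Qed.

Lemma omega_neq0 i j : (j <= N i)%N -> om i j != 0.
Proof.
rewrite -ltnS => jN; apply/eqP => oj0; apply: (@omega_notin i (Ordinal jN)).
by rewrite /= oj0; apply: ideal_adjoin_ideal; apply: ideal0.
Qed.

Lemma omega_homog i j : whomog p (wdeg p (w i) + j%:R) (om i j).
Proof.
have [hw _ _] := jordan; have [d hd] := hw i.
have -> : wdeg p (w i) = d.
  apply: wdeg_homog => //; have := @omega_neq0 i 0 (leq0n _).
  by rewrite /omega expr0 mul1r.
rewrite addrC -[j%:R]mulr1; apply: whomogM => //; apply: whomog_exp.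
exact: whomogN.
Qed.

Lemma nu_omega i j : (j <= N i)%N -> nuo (om i j) = nuo (w i) + j%:R.
Proof.
move=> jN; rewrite /nu (wdeg_homog (@omega_homog i j) (omega_neq0 jN)).
by rewrite -!addrA addrCA addrC -!addrA [- _ + _]addrC !addrA addrAC.
Qed.

Lemma omega_weight i j a : (j <= N i)%N -> (om i j)@_a != 0 ->
  weight p a = nuo (om i j) + \sum_k e k - \sum_k p k.
Proof.
move=> jN /(proj1 (whomogP _ _ _) (omega_homog (i := i) (j := j))) ->.
by rewrite nu_omega // /nu; ring.
Qed.

Lemma df_mul h k : df h -> df (k * h).
Proof. exact: ideal_adjoin_mul. Qed.

Lemma df_subspace : subspace df.
Proof. exact: ideal_adjoin_subspace. Qed.

(** Multiplication by [f] shifts the Jordan strings, so elements of its image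
    do not involve their first members. *)
Lemma mul_f_omega (x : jidx N) : exists m : jidx N -> C,
  df (f * om (tag x) (tagged x) - \sum_y m y *: om (tag y) (tagged y)) /\
  forall i, m (Tagged (fun i => 'I_(N i).+1) (ord0 : 'I_(N i).+1)) = 0.
Proof.
case: x => i j /=; case: (ltnP j (N i)) => [jN|Nj].
  pose y0 : jidx N := Tagged _ (Ordinal (jN : (j.+1 < (N i).+1)%N)).
  exists (fun y => - (y == y0)%:R); split; last first.
    by move=> i'; rewrite -tag_eqE /tag_eq /=; case: eqP => [->|_];
      rewrite ?tagged_asE ?oppr0.
  rewrite (bigD1 y0) //= big1 => [|y /negPf ->]; last by rewrite oppr0 scale0r.
  rewrite addr0 eqxx scaleN1r opprK omega_succ mulNr subrr.
  by case: df_subspace.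
exists (fun=> 0); split => //.
rewrite big1 ?subr0 => [|y _]; last by rewrite scale0r.
have [_ _ top] := jordan; suff -> : nat_of_ord j = N i by apply: top.
by apply/eqP; rewrite eqn_leq Nj -ltnS ltn_ord.
Qed.

(** Weights above 1 cannot occur at the start of a Jordan string: they exceed
    the socle degree of [O / (I + (f))], which is that of [J], and so belong to
    the image of multiplication by [f]. *)
Lemma nu_first_le1 i : nuo (w i) <= 1.
Proof.
rewrite leNgt; apply/negP => nu1.
have w0E : om i 0 = w i by rewrite /omega expr0 mul1r.
have [a fa] : ideal_adjoin I f (w i).
  apply: high_weight_mem => b; rewrite -w0E => /omega_weight -> //.
  by rewrite w0E !ltrD2r.
have [_ [_ span ind] _] := jordan.
have [c hc] := span a Logic.I.
have /choice [m hm] := mul_f_omega.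
pose x0 : jidx N := Tagged (fun i => 'I_(N i).+1) (ord0 : 'I_(N i).+1).
pose k y := (y == x0)%:R - \sum_x c x * m x y.
suff : k x0 = 0.
  rewrite /k eqxx big1 ?subr0 => [/eqP|x _]; first by rewrite oner_eq0.
  by have [_ ->] := hm x; rewrite mulr0.
apply: ind; set S := \sum_y _.
have dfs := df_subspace.
have -> : S = w i - \sum_x c x *: (\sum_y m x y *: om (tag y) (tagged y)).
  rewrite /S (eq_bigr (fun y => (y == x0)%:R *: om (tag y) (tagged y) -
      \sum_x (c x * m x y) *: om (tag y) (tagged y))); last first.
    by move=> y _; rewrite scalerBl scaler_suml.
  rewrite sumrB (bigD1 x0) //= eqxx scale1r big1 ?addr0 => [|y /negPf ->];
    last by rewrite scale0r.
  rewrite w0E exchange_big /=; congr (_ - _); apply: eq_bigr => x _.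
  by rewrite scaler_sumr; apply: eq_bigr => y _; rewrite scalerA.
have hcf : df (a * f - \sum_x c x *: (f * om (tag x) (tagged x))).
  rewrite [X in df X](_ : _ = f * (a - \sum_x c x *: om (tag x) (tagged x))).
    exact: df_mul.
  rewrite mulrBr mulrC mulr_sumr; congr (_ - _); apply: eq_bigr => x _.
  by rewrite scalerAr.
have hsum : df (\sum_x c x *: (f * om (tag x) (tagged x)) -
    \sum_x c x *: (\sum_y m x y *: om (tag y) (tagged y))).
  rewrite -sumrB; apply: subspace_sum => // x _.
  by rewrite -scalerBr; apply: subspaceZ => //; case: (hm x).
have hwf : df (w i - a * f) by apply: ideal_adjoin_ideal.
have := subspaceD dfs (subspaceD dfs hwf hcf) hsum.
by rewrite [X in X + _]addrA subrK addrA subrK.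
Qed.

(** [f] acts nilpotently on [O / (I + (J))], so that a power of the
    nonzerodivisor [f] is a multiple of [J]. *)
Lemma jac_nonzerodivisor h : I (h * J) -> I h.
Proof.
move=> hJ; pose K := (\max_i N i).+1.
have fom i j : (N i < j)%N -> df (om i j).
  elim: j => // j IHj; rewrite ltnS leq_eqVlt omega_succ => /orP [/eqP Nj|/IHj].
    rewrite -Nj mulNr; apply: subspaceN; first exact: df_subspace.
    by have [_ _] := jordan.
  exact: df_mul.
have omE i j k : om i (k + j) = (- f) ^+ k * om i j.
  by rewrite /omega exprD mulrA.
have [a ha] : df ((- f) ^+ K).
  have [_ [_ span _] _] := jordan; have [c hc] := span 1 Logic.I.
  have dfs := df_subspace.
  apply: (subspace_congr dfs (v := (- f) ^+ K *
      \sum_x c x *: om (tag x) (tagged x))).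
    by rewrite -[X in X - _]mulr1 -mulrBr; apply: df_mul.
  rewrite mulr_sumr; apply: subspace_sum => // x _; rewrite -scalerAr -omE.
  apply: subspaceZ => //; apply: fom.
  by rewrite addSn ltnS (leq_trans (leq_bigmax (tag x))) ?leq_addr.
have : I ((- f) ^+ K * h).
  rewrite -[_ ^+ K](subrK (a * J)) mulrDl; apply: idealD; first exact: idealMr.
  by rewrite -mulrA [J * h]mulrC; apply: idealMl.
elim: K {ha} => [|k IHk]; first by rewrite expr0 mul1r.
rewrite exprS -mulrA mulNr => /idealN; rewrite opprK.
by move=> /f_nonzerodivisor/IHk.
Qed.

(** The last member of a Jordan string: by Euler's identity [f omega = u df]
    means that [omega], up to the factor [nu omega], is exact with primitive
    [u].  The weight of [u], which is [nu omega], is nonnegative. *)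
Lemma last_omega i : exists u : O,
  [/\ I (f * om i (N i) - u * J),
      I (jac g u - ratr (nuo (om i (N i))) *: om i (N i))
    & 0 <= nuo (om i (N i))].
Proof.
have [_ _ top] := jordan; have [a ha] := top i.
pose s := 1 + \sum_k e k - \sum_k p k.
pose v := nuo (om i (N i)).
have Jhom : whomog p s J by apply: jac_homog.
pose u := wcomp p v a.
have hu : I (f * om i (N i) - u * J).
  have := ideal_wcomp (v + s) g_homog ha; rewrite linearB /=.
  rewrite (wcompM _ _ Jhom) addrK (wcomp_id (d := v + s)) //.
  have -> : v + s = 1 + (wdeg p (w i) + (N i)%:R).
    by rewrite /v nu_omega // /nu /s; ring.
  by apply: whomogM => //; apply: omega_homog.
have uhom : whomog p v u by apply: wcomp_homog.
exists u; split => //.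
  apply: f_nonzerodivisor; have := mul_jac_euler g_homog f_homog uhom.
  move=> h1; have h2 := idealMl (ratr v)%:MP hu.
  rewrite mulrBr.
  have -> : f * jac g u - f * (ratr v *: om i (N i)) =
    (f * jac g u - ratr v *: (u * J)) - (ratr v)%:MP * (f * om i (N i) - u * J).
    by rewrite !mul_mpolyC scalerBr opprB addrA subrK -scalerAr.
  exact: idealB.
rewrite leNgt; apply/negP => v0.
have u0 := whomog_neg p_gt0 uhom v0.
rewrite u0 mul0r subr0 in hu.
apply: (@omega_notin i (Ordinal (ltnSn (N i)))).
exact/ideal_adjoin_ideal/f_nonzerodivisor.
Qed.

(** * A basis of the Gauss-Manin system *)

Local Notation L := (laurent C n).
Local Notation rel := (GM0_rel g f).
Local Notation af := (@alpha_form C n).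
Local Notation omt := (@omega_tilde C n p e f mu2 N w).
Local Notation lambda := (@lam C n p e f mu2 N w).
Local Notation nux x := (nuo (om (tag x) (tagged x))).
Implicit Types (x : jidx N).

Definition jnext x : option (jidx N) :=
  omap (Tagged (fun i => 'I_(N i).+1))
    (insub (nat_of_ord (tagged x)).+1 : option 'I_(N (tag x)).+1).

(** The correction term vanishes exactly when [nu <= 1]; this removes the case
    distinction in the definition. *)
Lemma omega_tildeE x : omt x = af (om (tag x) (tagged x)) +
  ratr (Num.max 0 (nux x - 1)) *: tau (-1) (af (om (tag x) (tagged x).-1)).
Proof.
rewrite /omega_tilde; case: ltrP => v1.
  by rewrite max_r // subr_ge0 ltW.
by rewrite max_l ?subr_le0 // rmorph0 scale0r addr0.
Qed.

Lemma lam_ge0 x : 0 <= lambda x.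
Proof. by rewrite /lam; case: ifP => // _; case: ifP. Qed.

Lemma lam_le1 x : lambda x <= 1.
Proof. by rewrite /lam; case: ltrP => // v1; case: ifP. Qed.

Lemma euler_op_omega i j :
  euler_op f (af (om i j)) = tau 1 (af (om i j.+1)).
Proof. by rewrite euler_op_alpha_form omega_succ. Qed.

(** By [nu_first_le1] the correction occurs only for [j > 0], where
    [tau^-1 omega^(j-1)] is mapped to [omega^j - tau^-1 omega^(j-1)]: the second
    term cancels [lambda = 1] times the correction. *)
Lemma euler_op_omega_tilde x :
  euler_op f (omt x) + ratr (lambda x) *: omt x =
  euler_op f (af (om (tag x) (tagged x))) +
    ratr (Num.max 0 (nux x)) *: af (om (tag x) (tagged x)).
Proof.
case: x => i j; rewrite omega_tildeE /lam /=.
have jN : (j <= N i)%N by rewrite -ltnS.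
set v := nuo _; case: (ltrP 1 v) => v1; last first.
  rewrite (max_l (_ : v - 1 <= 0)) ?subr_le0 // rmorph0 scale0r addr0.
  by case: lerP.
have v0 : 0 <= v by apply: ltW; apply: lt_trans v1.
have v10 : 0 <= v - 1 by rewrite subr_ge0 ltW.
rewrite (max_r v0) (max_r v10) rmorph1 scale1r {v10}.
case: {jN} (nat_of_ord j) (jN) @v v1 v0 => [|k] kN v v1 v0.
  by rewrite /v nu_omega // addr0 ltNge nu_first_le1 in v1.
clearbody v; rewrite /= (linearD (euler_op f)) linearZZ /= euler_op_tau.
rewrite (euler_op_omega i k) (raddfD (tau (-1))) /= tauK rmorphN1 scaleN1r.
rewrite (raddfN (tau (-1))) /= scalerBr -!addrA; congr (_ + _).
rewrite [alpha_form _ + _]addrC addKr -[X in _ + X]scale1r -scalerDl.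
by rewrite -[X in _ + X](rmorph1 (@ratr C)) -rmorphD subrK.
Qed.

Lemma euler_op_omega_last i : rel (euler_op f (af (om i (N i))) +
  ratr (nuo (om i (N i))) *: af (om i (N i))).
Proof.
have [u [hu1 hu0 _]] := last_omega i.
apply/GM0_relP; exists (af u) => j; rewrite euler_op_alpha_form.
rewrite coeff_laurentD coeff_laurentZ coeff_tau !coeff_alpha_form.
have [->|j0] := eqVneq j 0.
  rewrite sub0r oppr_eq0 oner_eq0 !mulr0 !mulr1 mul0r add0r subr0 -opprB.
  exact: idealN.
rewrite !mulr0 scaler0 linear0 sub0r opprK addr0.
case: (j - 1 == 0); rewrite ?mulr0 ?mul0r ?addr0; last exact: ideal0.
by rewrite !mulr1 -[_ + _]opprK opprD mulNr opprK; apply: idealN.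
Qed.

(** The term [nu^j omega^j] left by [euler_op_omega_tilde] is the correction of
    [tau omega_tilde^(j+1)] when [j < N], and is cancelled by
    [tau d_tau omega^N] when [j = N].  In the latter case [Num.max 0 nu = nu]
    because the weight of the end of a string is nonnegative. *)
Lemma euler_op_omega_tilde_next x :
  rel (euler_op f (omt x) + ratr (lambda x) *: omt x -
       (if jnext x is Some y then tau 1 (omt y) else 0)).
Proof.
rewrite euler_op_omega_tilde; case: x => i j; rewrite /jnext /=.
case: insubP => [k _ kj|] /=.
  rewrite omega_tildeE /= kj /= linearD linearZZ /= tauD tau0 euler_op_omega.
  have kN : (j.+1 <= N i)%N by rewrite -kj -ltnS ltn_ord.
  have -> : nuo (om i j.+1) - 1 = nuo (om i j).
    by rewrite (nu_omega kN) (nu_omega (ltnW kN)) -natr1 addrA addrK.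
  rewrite subrr; exact: (proj1 (GM0_rel_subspace g f)).
rewrite ltnS -leqNgt => Nj.
have -> : nat_of_ord j = N i by apply/eqP; rewrite eqn_leq Nj -ltnS ltn_ord.
have [u [_ _ v0]] := last_omega i.
by rewrite max_r // subr0; apply: euler_op_omega_last.
Qed.

Definition gm_index := (jidx N * int)%type.
Implicit Types (y z : gm_index).

Definition gm_basis (y : gm_index) : L := tau y.2 (omt y.1).

Definition gm_weight (y : gm_index) : rat := lambda y.1 - y.2%:~R.

Definition gm_rank (y : gm_index) : nat := tagged y.1.

Definition gm_next (y : gm_index) : option gm_index :=
  omap (fun x => (x, y.2 + 1)) (jnext y.1).

Lemma gm_rank_le y : (gm_rank y <= \max_i N i)%N.
Proof.
case: y => [[i j] k]; rewrite /gm_rank /=.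
by apply: (leq_trans _ (leq_bigmax i)); rewrite -ltnS.
Qed.

Lemma gm_next_rank y z : gm_next y = Some z -> gm_rank z = (gm_rank y).+1.
Proof.
case: y => [[i j] k]; rewrite /gm_next /jnext /=.
by case: insubP => [l _ lj|] //= [<-].
Qed.

Lemma gm_next_weight y z : gm_next y = Some z -> gm_weight z <= gm_weight y.
Proof.
case: y => [[i j] k]; rewrite /gm_next /jnext /=.
case: insubP => [l _ lj|] //= [<-]; rewrite /gm_weight /= rmorphD opprD addrA.
rewrite addrAC lerD2r lerBlDr; apply: le_trans (lam_le1 _) _.
by rewrite lerDr lam_ge0.
Qed.

Lemma gm_basis_euler_op y :
  rel (shifted (euler_op f) (gm_weight y) (gm_basis y) -
       (if gm_next y is Some z then gm_basis z else 0)).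
Proof.
case: y => x k; rewrite /gm_next /gm_weight /gm_basis /shifted /=.
have := GM0_rel_tau k (euler_op_omega_tilde_next x).
have -> (c : C) (u : L) : euler_op f (tau k u) + c *: tau k u =
    tau k (euler_op f u + (k%:~R + c) *: u).
  by rewrite euler_op_tau !(raddfD (tau k)) /= !linearZZ /= scalerDl addrA.
have -> : k%:~R + ratr (lambda x - k%:~R) = ratr (lambda x) :> C.
  by rewrite rmorphB /= ratr_int addrC subrK.
by rewrite linearB /=; case: (jnext x) => [y|] /=; rewrite ?tauD ?linear0.
Qed.

Lemma coeff_gm_basis k y : y.2 <= k ->
  coeff k (gm_basis y) = om (tag y.1) (tagged y.1) * (y.2 == k)%:R.
Proof.
move=> yk; rewrite coeff_tau omega_tildeE coeff_laurentD coeff_laurentZ.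
rewrite coeff_tau !coeff_alpha_form subr_eq0 eq_sym opprK.
have /negPf -> : k - y.2 + 1 != 0.
  by rewrite lt0r_neq0 // ltr_wpDl // subr_ge0.
by rewrite mulr0 scaler0 addr0.
Qed.

Lemma int_seq_bound (s : seq int) : exists B : int, {in s, forall k, k <= B}.
Proof.
elim: s => [|k s [B hB]]; first by exists 0.
exists (Num.max k B) => l; rewrite inE => /orP [/eqP ->|/hB lB].
  by rewrite le_max lexx.
by rewrite le_max lB orbT.
Qed.

(** Let [u] be congruent to [(d - tau df) a].  Descending from large powers of
    [tau], the products [coeff k a * J] with [k >= K] belong to [I], hence so do
    the [coeff k a], since [J] is a nonzerodivisor modulo [I].  What remains of
    the coefficient of [u] at [K] is the multiple [- coeff (K - 1) a * J]. *)
Lemma rel_top_coeff (u : L) (K : int) :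
  rel u -> (forall k : int, K < k -> coeff k u = 0) -> df (coeff K u).
Proof.
move=> /GM0_relP [a ha] uK.
have [B hB] := int_seq_bound (dom a).
have aI : forall (m : nat) (j : int), K <= j -> B - m%:Z < j -> I (coeff j a).
  elim=> [|m IHm] j Kj Bj.
    rewrite coeff_outdom; first exact: ideal0.
    by apply/negP => /hB; rewrite leNgt -[B]subr0 Bj.
  have Kj1 : K < j + 1 by rewrite ltzD1.
  have := ha (j + 1); rewrite uK // addrK sub0r opprB => h.
  apply: jac_nonzerodivisor; apply: ideal_congr h _.
  apply: jac_ideal; apply: IHm; first exact: ltW.
  by move: Bj; rewrite -addn1 PoszD opprD addrA ltrBlDr.
have aK : I (coeff K a).
  have := aI (absz (B - (K - 1))%R) K (lexx K); apply; rewrite abszE.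
  apply: (@le_lt_trans _ _ (K - 1)); last by rewrite ltrBlDr ltrDl.
  by rewrite lerBlDr addrC -lerBlDr ler_norm.
exists (- coeff (K - 1) a); rewrite mulNr opprK.
have -> : coeff K u + coeff (K - 1) a * J =
    coeff K u - (jac g (coeff K a) - coeff (K - 1) a * J) + jac g (coeff K a).
  by rewrite opprB addrA subrK.
by apply: idealD; [apply: ha|apply: jac_ideal].
Qed.

Lemma gm_basis_free (c : {freeg gm_index / C}) :
  rel (fglift gm_basis c) -> c = 0.
Proof.
move=> hc; apply: contrapT => /eqP; rewrite -dom_eq0 => c0.
have [y0 y0c ymax] : exists2 y0, y0 \in dom c &
    {in dom c, forall y : gm_index, y.2 <= y0.2}.
  elim: (dom c) c0 => // y [|z s] IHs _.
    by exists y; rewrite ?inE // => z; rewrite inE => /eqP ->.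
  have [//|y0 y0s ymax] := IHs; have [yy0|y0y] := lerP y.2 y0.2.
    exists y0; first by rewrite inE y0s orbT.
    by move=> t; rewrite inE => /orP [/eqP -> //|/ymax].
  exists y; first by rewrite inE eqxx.
  move=> t; rewrite inE => /orP [/eqP -> //|/ymax ty0].
  exact: le_trans ty0 (ltW y0y).
have coefE k : y0.2 <= k -> coeff k (fglift gm_basis c) =
    \sum_(y <- dom c) coeff y c *: (om (tag y.1) (tagged y.1) * (y.2 == k)%:R).
  move=> k0; rewrite fglift_sum coeff_laurent_sum; apply: eq_big_seq => y yc.
  by rewrite coeff_laurentZ coeff_gm_basis // (le_trans (ymax _ yc)).
have := rel_top_coeff (K := y0.2) hc; rewrite coefE // => top.
have {}top : df (\sum_x coeff (x, y0.2) c *: om (tag x) (tagged x)).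
  suff -> : \sum_x coeff (x, y0.2) c *: om (tag x) (tagged x) =
      \sum_(y <- dom c)
        coeff y c *: (om (tag y.1) (tagged y.1) * (y.2 == y0.2)%:R).
    apply: top => k k0; rewrite coefE ?(ltW k0) // big_seq big1 // => y yc.
    by rewrite lt_eqF ?mulr0 ?scaler0 // (le_lt_trans (ymax _ yc)).
  pose P (y : gm_index) := y.2 == y0.2.
  rewrite [RHS](bigID P) /= [X in _ + X]big1 ?addr0 => [|y /negPf]; last first.
    by rewrite /P => ->; rewrite mulr0 scaler0.
  rewrite (eq_bigr (fun y : gm_index =>
      coeff y c *: om (tag y.1) (tagged y.1))) => [|y /eqP ->]; last first.
    by rewrite eqxx mulr1.
  rewrite -[RHS]big_filter.
  rewrite (bigID (fun x => (x, y0.2) \in dom c)) /= [X in _ + X]big1 ?addr0;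
    last by move=> x /coeff_outdom ->; rewrite scale0r.
  rewrite -[LHS]big_filter.
  rewrite -(big_map (fun x => (x, y0.2)) xpredT
    (fun y : gm_index => coeff y c *: om (tag y.1) (tagged y.1))).
  apply: perm_big; apply: uniq_perm.
  - rewrite map_inj_uniq; last by move=> x x' [].
    by rewrite filter_uniq // index_enum_uniq.
  - by rewrite filter_uniq // uniq_dom.
  move=> [x k]; rewrite mem_filter /P /=; apply/mapP/andP => [[x']|[/eqP -> xc]].
    by rewrite mem_filter => /andP [x'c _] [-> ->].
  by exists x => //; rewrite mem_filter xc mem_index_enum.
have [_ [_ _ ind] _] := jordan.
have /eqP := ind _ top y0.1; apply/negP.
by rewrite -surjective_pairing -mem_dom.
Qed.

Local Notation span_le k :=
  (spanned gm_basis rel (fun y : gm_index => y.2 <= k)).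

Lemma span_le_mono k l (u : L) : k <= l -> span_le k u -> span_le l u.
Proof. by move=> kl; apply: spanned_sub => y yk; apply: le_trans kl. Qed.

Lemma span_le_tau l k (u : L) : span_le k u -> span_le (l + k) (tau l u).
Proof.
have spans := spanned_subspace gm_basis (GM0_rel_subspace g f).
have tauS : subspace [set u | span_le (l + k) (tau l u)].
  split; first by change (span_le (l + k) (tau l 0));
    rewrite linear0; apply: (proj1 (spans _)).
  move=> c v v' hv hv'; change (span_le (l + k) (tau l (c *: v + v'))).
  by rewrite linearP; apply: (proj2 (spans _)).
apply: (spanned_min tauS).
- by move=> v hv; apply: rel_spanned; apply: GM0_rel_tau.
- move=> y yk; rewrite /mkset tauD.
  apply: (mem_spanned gm_basis (GM0_rel_subspace g f) (y := (y.1, l + y.2))).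
  by rewrite /= lerD2l.
Qed.

Lemma omega_span x : span_le 0 (af (om (tag x) (tagged x))).
Proof.
have relS := GM0_rel_subspace g f.
have spans := spanned_subspace gm_basis relS.
case: x => i [j jN] /=; elim: j jN => [|j IHj] jN.
all: have := mem_spanned gm_basis relS (P := fun y => y.2 <= 0)
  (y := (Tagged (fun i => 'I_(N i).+1) (Ordinal jN), 0)) (lexx 0).
all: rewrite /gm_basis /= tau0 omega_tildeE /=.
  rewrite max_l ?rmorph0 ?scale0r ?addr0 //.
  by rewrite nu_omega // addr0 subr_le0 nu_first_le1.
move=> hb; apply: (subspace_congr (spans _) _ hb).
rewrite opprD addrA subrr sub0r; apply: subspaceN; first exact: spans.
apply: subspaceZ; first exact: spans.
by apply: (span_le_mono (k := -1 + 0)) => //; apply/span_le_tau/IHj/ltnW.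
Qed.

(** In the quotient, [a J alpha = tau ^ -1 da] where [da] has smaller weight,
    so that the powers of [tau] needed to express [h alpha] by the basis are
    bounded above by 0. *)
Lemma alpha_form_span_homog (m : nat) d h :
  whomog p d h -> d < m%:R -> span_le 0 (af h).
Proof.
have relS := GM0_rel_subspace g f.
have spans := spanned_subspace gm_basis relS.
elim: m d h => [|m IHm] d h hh dm.
  rewrite (whomog_neg p_gt0 hh dm) linear0; exact: proj1 (spans _).
have [_ [_ span _] _] := jordan; have [c [a ha]] := span h Logic.I.
pose s := 1 + \sum_k e k - \sum_k p k.
have Jhom : whomog p s J by apply: jac_homog.
pose a' := wcomp p (d - s) a.
pose c' x := if wdeg p (w (tag x)) + (tagged x)%:R == d then c x else 0.
have hI : I (h - \sum_x c' x *: om (tag x) (tagged x) - a' * J).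
  have sumE : wcomp p d (\sum_x c x *: om (tag x) (tagged x)) =
      \sum_x c' x *: om (tag x) (tagged x).
    rewrite linear_sum; apply: eq_bigr => x _; rewrite linearZZ /= /c'.
    case: eqP => [xd|/eqP xd].
      by rewrite wcomp_id // -xd; apply: omega_homog.
    by rewrite (wcomp_neq (@omega_homog (tag x) (tagged x)) xd) scaler0 scale0r.
  rewrite -sumE -[h in X in I X](wcomp_id hh) /a' -(wcompM _ _ Jhom).
  rewrite -!(raddfB (wcomp p d)) /=; exact: ideal_wcomp ha.
have h0 : rel (af (h - \sum_x c' x *: om (tag x) (tagged x) - a' * J)).
  apply/GM0_relP; exists 0 => j; rewrite !coeff0 linear0 mul0r !subr0.
  by rewrite coeff_alpha_form; apply: idealMr.
have ha' : span_le 0 (af (a' * J)).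
  have -> : af (a' * J) = tau (-1) (af (jac g a')) -
      tau (-1) (af (jac g a') - tau 1 (af (a' * J))).
    by rewrite linearB /= tauK opprB addrC subrK.
  apply: subspaceB; first exact: spans.
    apply: (span_le_mono (k := -1 + 0)) => //; apply: span_le_tau.
    apply: (IHm (d - 1)); last by rewrite ltrBlDr natr1.
    have := jac_homog g_homog (@wcomp_homog _ _ p (d - s) a).
    by rewrite [X in whomog p X](_ : _ = d - 1) // /s; ring.
  apply: rel_spanned; apply: GM0_rel_tau; apply/GM0_relP; exists (af a') => j.
  rewrite coeff_laurentB coeff_tau !coeff_alpha_form.
  have -> : jac g (a' * (j == 0)%:R) = jac g a' * (j == 0)%:R.
    by case: (j == 0); rewrite ?mulr1 // !mulr0 linear0.
  by rewrite [_ * _ * J]mulrAC subrr; apply: ideal0.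
have -> : af h = af (h - \sum_x c' x *: om (tag x) (tagged x) - a' * J) +
    af (\sum_x c' x *: om (tag x) (tagged x)) + af (a' * J).
  by rewrite -!(raddfD af) /= [X in X + a' * J]addrAC !subrK.
apply: subspaceD => //; apply: subspaceD => //; first exact: rel_spanned.
rewrite linear_sum; apply: subspace_sum => // x _; rewrite linearZZ.
by apply: subspaceZ => //; apply: omega_span.
Qed.

Lemma alpha_form_span h : span_le 0 (af h).
Proof.
rewrite (mpolyE h) linear_sum.
have spans := spanned_subspace gm_basis (GM0_rel_subspace g f).
apply: subspace_sum => // a _; rewrite linearZZ; apply: subspaceZ => //.
apply: (alpha_form_span_homog (@whomogX C _ p a)
  (archi_boundP (weight_ge0 a p_gt0))).
Qed.

Lemma gm_basis_span (u : L) :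
  exists c : {freeg gm_index / C}, rel (u - fglift gm_basis c).
Proof.
suff [c [hc _]] : spanned gm_basis rel xpredT u by exists c.
have spans := spanned_subspace gm_basis (GM0_rel_subspace g f).
rewrite (laurent_sum_tau u); apply: subspace_sum => // k _.
by apply: (spanned_sub _ (span_le_tau k (alpha_form_span _))).
Qed.

Lemma lattice0E : lattice0 g f = span_le 0.
Proof.
have relS := GM0_rel_subspace g f.
have spans := spanned_subspace gm_basis relS.
rewrite eqEsubset; split => u.
  move=> [v v0 huv]; apply: (subspace_congr (spans _) (rel_spanned _ _ huv)).
  rewrite (laurent_sum_tau v); apply: subspace_sum_seq => // k kv.
  apply: (span_le_mono (k := k + 0)); last exact/span_le_tau/alpha_form_span.
  by rewrite addr0 leNgt; apply: contraTN kv => /v0 kv; rewrite mem_dom kv eqxx.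
move=> [c [hc cP]]; exists (fglift gm_basis c) => // k k0.
rewrite fglift_sum [LHS]coeff_laurent_sum big_seq big1 // => y.
rewrite mem_dom => /cP y0; rewrite coeff_laurentZ coeff_gm_basis.
  by rewrite lt_eqF ?mulr0 ?scaler0 // (le_lt_trans y0).
exact: le_trans y0 (ltW k0).
Qed.

Variable V : rat -> set L.
Hypothesis V_MK : MK_filtration g f V.
Implicit Types (l : rat).

(** * The spectrum *)

Lemma MK_spanned l :
  V l = spanned gm_basis rel (fun y => gm_weight y <= l).
Proof.
have relS := GM0_rel_subspace g f.
apply: (@filtration_spanned C L rel (euler_op f) V relS
  (@GM0_rel_euler_op C n g f) (MK_rel V_MK) (MK_subspace V_MK)
  (MK_euler_op V_MK) (MK_increasing V_MK) _ _ (MK_jumps V_MK)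
  (MK_separated V_MK) gm_index gm_basis gm_weight gm_rank gm_next
  (\max_i N i) gm_basis_span gm_basis_free gm_rank_le gm_next_rank
  gm_next_weight gm_basis_euler_op).
- move=> u; have : (\bigcup_l V l) u by rewrite (MK_exhaustive V_MK).
  by case=> m _ Vu; exists m.
- move=> m; have [k hk] := MK_nilpotent V_MK m; exists k => u /hk [m' m'm Vu].
  by exists m'.
Qed.

Lemma Vlt_spanned l :
  Vlt V l = spanned gm_basis rel (fun y => gm_weight y < l).
Proof.
have relS := GM0_rel_subspace g f.
have VltE u : Vlt V l u <-> below V l u by split; case=> k; exists k.
rewrite eqEsubset; split => u.
  case=> k /= kl; rewrite MK_spanned; apply: spanned_sub => y yk.
  exact: le_lt_trans kl.
move=> hu; apply/VltE; move: hu.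
apply: (spanned_min (below_subspace (MK_subspace V_MK) (MK_increasing V_MK) l)).
  move=> v hv; exists (l - 1); first by rewrite ltrBlDr ltrDl.
  exact: (MK_rel V_MK).
move=> y yl; exists (gm_weight y) => //; rewrite MK_spanned.
exact: (mem_spanned gm_basis relS).
Qed.

Lemma tau_inv_lattice0E : tau (- 1) @` lattice0 g f = span_le (-1).
Proof.
rewrite lattice0E eqEsubset; split => u.
  by case=> v hv <-; apply: (span_le_tau (-1) hv).
move=> hu; exists (tau 1 u); first exact: (span_le_tau 1 hu).
by rewrite tauK.
Qed.

Lemma grV_numE l : grV_num g f V l =
  spanned gm_basis rel (fun y => (gm_weight y <= l) && (y.2 <= 0)).
Proof.
rewrite /grV_num MK_spanned lattice0E spannedI //.
  exact: GM0_rel_subspace.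
exact: gm_basis_free.
Qed.

Lemma grV_denE l : grV_den g f V l = spanned gm_basis rel
  (fun y => (gm_weight y <= l) && (y.2 <= -1) ||
            (gm_weight y < l) && (y.2 <= 0)).
Proof.
have relS := GM0_rel_subspace g f.
rewrite /grV_den MK_spanned Vlt_spanned tau_inv_lattice0E lattice0E.
by rewrite !(spannedI relS gm_basis_free) -(spannedU _ relS).
Qed.

Lemma grV_quot_basis l :
  quot_basis (grV_num g f V l) (grV_den g f V l)
    (fun x : {x : jidx N | lambda x == l} => omt (val x)).
Proof.
have relS := GM0_rel_subspace g f.
pose i (x : {x : jidx N | lambda x == l}) : gm_index := (val x, 0).
have -> : (fun x : {x : jidx N | lambda x == l} => omt (val x)) = gm_basis \o i.
  by apply/funext => x; rewrite /gm_basis /= tau0.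
rewrite grV_numE grV_denE; apply: (spanned_quot_basis relS gm_basis_free).
- by move=> x x' [/val_inj].
- move=> y /orP [/andP [-> /= y1]|/andP [/ltW -> -> //]].
  exact: le_trans y1 _.
- move=> x; rewrite /gm_weight /= (eqP (valP x)) subr0 lexx ltxx.
  by split.
move=> [x k] /=; rewrite /gm_weight /= => /andP [xl k0].
rewrite negb_or !negb_and xl k0 /= orbF -ltNge -leNgt => /andP [k1 lx].
have {k0 k1} k0 : k = 0.
  by apply/eqP; rewrite eq_le k0 -[0](addNr 1) lezD1.
rewrite k0 subr0 in xl lx.
have lxE : lambda x == l by rewrite eq_le xl lx.
by exists (exist _ x lxE); rewrite k0.
Qed.

Lemma grV_quot_dim l : quot_dim (grV_num g f V l) (grV_den g f V l)
  #|[pred x | lambda x == l]|.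
Proof.
by have := quot_basis_dim (grV_quot_basis l); rewrite card_sig.
Qed.

Lemma spectrumE : spectrum g f V =
  [set (l, #|[pred x | lambda x == l]|) | l in range lambda].
Proof.
rewrite eqEsubset; split => [[l d]|].
  rewrite /spectrum /= => -[hd d0].
  have dE : d = #|[pred x | lambda x == l]|.
    apply: quot_dim_uniq hd (grV_quot_dim l); rewrite grV_denE.
    exact/spanned_subspace/GM0_rel_subspace.
  exists l; last by rewrite dE.
  move: d0; rewrite dE -lt0n => /card_gt0P [x /eqP xl].
  by exists x.
move=> _ [l [x _ xl] <-]; split => /=; first exact: grV_quot_dim.
by rewrite -lt0n; apply/card_gt0P; exists x; rewrite inE xl.
Qed.

End JordanStrings.

Theorem theorem4p7 (R : realType) (n : nat)
    (p : 'I_n.+1 -> rat) (e : 'I_n -> rat)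
    (g : 'I_n -> {mpoly R[i][n.+1]}) (f : {mpoly R[i][n.+1]})
    (p_gt0 : forall i, 0 < p i)
    (g_homog : forall i, whomog p (e i) (g i))
    (curve : reduced_ci_curve g)
    (singular : ~ smooth_curve g)
    (f_homog : whomog p 1 f)
    (f_branches : nonconstant_on_branches g f)
    (mu2 : nat)
    (mu2_dim : quot_dim (V := {mpoly R[i][n.+1]})
                 setT (ideal_adjoin (ideal g) f) mu2.+1)
    (N : 'I_mu2 -> nat) (w : 'I_mu2 -> {mpoly R[i][n.+1]})
    (jordan : homog_jordan_basis p g f N w)
    (V : rat -> set (laurent R[i] n))
    (V_MK : MK_filtration g f V) :
  let lambda := lam p e f w (N := N) in
  let omegat := omega_tilde p e f w (N := N) in
  let mult (l : rat) := #|[pred x : jidx N | lambda x == l]| in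
  [/\ forall l : rat, (exists x, lambda x = l) ->
        quot_basis (grV_num g f V l) (grV_den g f V l)
          (fun x : {x : jidx N | lambda x == l} => omegat (val x)),
      forall l : rat,
        quot_dim (grV_num g f V l) (grV_den g f V l) (mult l)
    & spectrum g f V = [set (l, mult l) | l in range lambda]].
Proof.
have [_ rad] := curve; split=> [l _|l|].
- exact: (grV_quot_basis p_gt0 g_homog f_homog rad f_branches mu2_dim).
- exact: (grV_quot_dim p_gt0 g_homog f_homog rad f_branches mu2_dim).
exact: (spectrumE p_gt0 g_homog f_homog rad f_branches mu2_dim).
Qed.
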